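(* Let $E$ be a directed graph, $K$ a field with an involution, and $(H,S)$ an admissible pair of $E$. Then the graded ideal $I(H,S)$ of the Leavitt path algebra $L_K(E)$ and the Leavitt path algebra $L_K(P_{(H,S)})$ of the porcupine graph $P_{(H,S)}$ are graded $*$-isomorphic, i.e., there is a $K$-algebra isomorphism $L_K(P_{(H,S)})\to I(H,S)$ which is a graded homomorphism (with respect to the natural $\mathbb Z$-gradings) and a $*$-homomorphism. Thus, every graded ideal of a Leavitt path algebra is graded $*$-isomorphic to a Leavitt path algebra.
   Context: **Graphs.** $E$ is an arbitrary directed graph with vertex set $E^0$, edge set $E^1$, and source and range maps $\mathbf{s},\mathbf{r}:E^1\to E^0$. A sink is a vertex emitting no edges; an infinite emitter is a vertex emitting infinitely many edges; a vertex is regular if it is neither a sink nor an infinite emitter. A path is a single vertex (length $0$) or a finite sequence of edges $e_1e_2\ldots e_n$ ($n\ge 1$, length $n$) with $\mathbf r(e_i)=\mathbf s(e_{i+1})$ for $i=1,\dots,n-1$; $|p|$ denotes the length of $p$, and $\mathbf s,\mathbf r$ extend to paths in the obvious way. **Leavitt path algebras.** Let $K$ be a field with an involution $k\mapsto k^*$ (any involution, possibly the identity). $L_K(E)$ is the (not necessarily unital) associative $K$-algebra generated by $E^0\cup E^1\cup\{e^*\mid e\in E^1\}$ subject to, for all vertices $v,w$ and edges $e,f$: (V) $vw=0$ if $v\ne w$ and $vv=v$; (E1) $\mathbf s(e)e=e\mathbf r(e)=e$; (E2) $\mathbf r(e)e^*=e^*\mathbf s(e)=e^*$; (CK1) $e^*f=0$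 if $e\neq f$ and $e^*e=\mathbf r(e)$; (CK2) $v=\sum_{e\in\mathbf s^{-1}(v)}ee^*$ for each regular vertex $v$. Put $v^*=v$ for vertices and $p^*=e_n^*\ldots e_1^*$ for a path $p=e_1\ldots e_n$. Every element is a $K$-linear combination of elements $pq^*$ with $p,q$ paths; the involution of $L_K(E)$ is $(\sum k_ip_iq_i^* )^*=\sum k_i^*q_ip_i^*$. $L_K(E)$ is $\mathbb Z$-graded, with $L_K(E)_n$ the $K$-linear span of the $pq^*$ with $|p|-|q|=n$. A graded ideal is a two-sided ideal $I$ with $I=\bigoplus_n (I\cap L_K(E)_n)$; it is graded by $I_n=I\cap L_K(E)_n$. A homomorphism $\phi$ is graded if it maps the $n$-component to the $n$-component for all $n\in\mathbb Z$, and is a $*$-homomorphism if $\phi(x^* )=\phi(x)^*$ for all $x$. **Admissible pairs.** $H\subseteq E^0$ is hereditary if $\mathbf r(p)\in H$ for every path $p$ with $\mathbf s(p)\in H$, and saturated if $v\in H$ for every regular vertex $v$ with $\mathbf r(\mathbf s^{-1}(v))\subseteq H$. For $H$ hereditary and saturated, let $$B_H=\{v\in E^0-H\mid v\text{ is an infinite emitter and }\mathbf s^{-1}(v)\cap\mathbf r^{-1}(E^0-H)\text{ is nonempty and finite}\}$$ and, for $v\in B_H$, $v^H=v-\sum_{e\in\mathbf s^{-1}(v)\cap\mathbf r^{-1}(E^0-H)}ee^*$. An admissible pair is a pair $(H,S)$ with $H\subseteq E^0$ hereditary and saturated and $S\subseteq B_H$. $I(H,S)$ denotes the (graded) ideal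 of $L_K(E)$ generated by $H\cup\{v^H\mid v\in S\}$. **Porcupine graph.** For an admissible pair $(H,S)$ let $$F_1(H,S)=\{e_1\ldots e_n\text{ a path of }E,\ n\ge1\mid \mathbf r(e_n)\in H,\ \mathbf s(e_n)\notin H\cup S\},$$ $$F_2(H,S)=\{p\text{ a path of }E\mid \mathbf r(p)\in S,\ |p|>0\}.$$ For each $p\in F_1(H,S)\cup F_2(H,S)$ introduce a new vertex $w^p$ and a new edge $f^p$ (distinct for distinct $p$). The porcupine graph $P_{(H,S)}$ has vertex set $$H\cup S\cup\{w^p\mid p\in F_1(H,S)\cup F_2(H,S)\}$$ and edge set $$\{e\in E^1\mid \mathbf s(e)\in H\}\cup\{e\in E^1\mid \mathbf s(e)\in S,\ \mathbf r(e)\in H\}\cup\{f^p\mid p\in F_1(H,S)\cup F_2(H,S)\}.$$ The source and range of edges from $E^1$ are as in $E$. For the new edges, $\mathbf s(f^p)=w^p$; if $p=e$ is a single edge (length $1$), then $\mathbf r(f^e)=\mathbf r(e)$; if $p=eq$ with $e\in E^1$, $q\in F_1(H,S)\cup F_2(H,S)$ and $|q|\ge 1$, then $\mathbf r(f^p)=w^q$. *)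

(* Defs.v *)
From HB Require Import structures.
From mathcomp Require Import all_boot all_order all_algebra.
From mathcomp Require Import generic_quotient finmap.
From mathcomp Require Import all_classical.

Set Implicit Arguments.
Unset Strict Implicit.
Unset Printing Implicit Defensive.

Import GRing.Theory.

Local Open Scope classical_set_scope.
Local Open Scope ring_scope.
Local Open Scope quotient_scope.

HB.mixin Record Lmodule_isNonUnitalAlgebra (K : fieldType) A
    of GRing.Lmodule K A := {
  numul : A -> A -> A;
  numulA : associative numul;
  numulDl : left_distributive numul +%R;
  numulDr : right_distributive numul +%R;
  numulZl : forall (k : K) (x y : A), numul (k *: x) y = k *: numul x y;
  numulZr : forall (k : K) (x y : A), numul x (k *: y) = k *: numul x y
}.

#[short(type="nonUnitalAlgType")]
HB.structure Definition NonUnitalAlgebra (K : fieldType) :=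
  {A of GRing.Lmodule K A & Lmodule_isNonUnitalAlgebra K A}.

Notation "x ** y" := (numul x y) (at level 40, left associativity) : ring_scope.

Definition lin_span (K : fieldType) (V : lmodType K) (G : set V) : set V :=
  [set x | exists s : seq (K * V),
     {in s, forall c, G c.2} /\ x = \sum_(c <- s) c.1 *: c.2].

(* Ideals are those of a K-algebra, hence K-subspaces; as L_K(E) has local
   units, its ring ideals are K-subspaces anyway. *)
Record two_sided_ideal (K : fieldType) (A : nonUnitalAlgType K) (I : set A)
    : Prop := {
  ideal0 : I 0;
  idealD : forall x y, I x -> I y -> I (x + y);
  idealZ : forall (k : K) x, I x -> I (k *: x);
  idealMl : forall a x, I x -> I (a ** x);
  idealMr : forall a x, I x -> I (x ** a)
}.

Definition ideal_gen (K : fieldType) (A : nonUnitalAlgType K) (G : set A)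
    : set A :=
  smallest (@two_sided_ideal K A) G.

Record digraph := Digraph {
  vertex : Type;
  edge : Type;
  src : edge -> vertex;
  rng : edge -> vertex
}.
Arguments src {d} _.
Arguments rng {d} _.

HB.instance Definition _ (E : digraph) := gen_eqMixin (vertex E).
HB.instance Definition _ (E : digraph) := gen_choiceMixin (vertex E).
HB.instance Definition _ (E : digraph) := gen_eqMixin (edge E).
HB.instance Definition _ (E : digraph) := gen_choiceMixin (edge E).

Section Graphs.
Variable E : digraph.
Implicit Types (v : vertex E) (H S : set (vertex E)).

Definition out_edges v : set (edge E) := [set e | src e = v].
Definition in_edges_of (A : set (vertex E)) : set (edge E) :=
  [set e | A (rng e)].

Definition sink v := out_edges v = set0.
Definition infinite_emitter v := infinite_set (out_edges v).
Definition regular v := ~ sink v /\ ~ infinite_emitter v.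

(* The pair (e, s) stands for the path e s_1 ... s_k of length k + 1. *)
Definition nepath : Type :=
  {p : edge E * seq (edge E) | path (fun e f => rng e == src f) p.1 p.2}.

Definition first_edge (p : nepath) : edge E := (val p).1.
Definition last_edge (p : nepath) : edge E := last (val p).1 (val p).2.

Inductive gpath := VertexPath of vertex E | EdgePath of nepath.

Definition psrc (p : gpath) : vertex E :=
  match p with VertexPath v => v | EdgePath q => src (first_edge q) end.
Definition prng (p : gpath) : vertex E :=
  match p with VertexPath v => v | EdgePath q => rng (last_edge q) end.
Definition plen (p : gpath) : nat :=
  match p with VertexPath _ => 0%N | EdgePath q => (size (val q).2).+1 end.

Definition hereditary H := forall p : gpath, H (psrc p) -> H (prng p).
Definition saturated H :=
  forall v, regular v -> rng @` out_edges v `<=` H -> H v.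

Definition breaking H : set (vertex E) :=
  [set v | [/\ ~ H v, infinite_emitter v,
               out_edges v `&` in_edges_of (~` H) !=set0
             & finite_set (out_edges v `&` in_edges_of (~` H))]].

Record admissible_pair H S : Prop := {
  adm_hereditary : hereditary H;
  adm_saturated : saturated H;
  adm_breaking : S `<=` breaking H
}.

Definition porc_F1 H S : set nepath :=
  [set p | H (rng (last_edge p)) /\ ~ (H `|` S) (src (last_edge p))].
Definition porc_F2 S : set nepath := [set p | S (rng (last_edge p))].
Definition porc_F H S : set nepath := porc_F1 H S `|` porc_F2 S.

Definition porc_old_edges H S : set (edge E) :=
  [set e | H (src e)] `|` [set e | S (src e) /\ H (rng e)].

(* [inr p] is the new vertex w^p, resp. the new edge f^p. *)
Definition porc_vertex H S : Type :=
  (set_type (H `|` S) + set_type (porc_F H S))%type.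
Definition porc_edge H S : Type :=
  (set_type (porc_old_edges H S) + set_type (porc_F H S))%type.

Lemma porc_old_src H S e : porc_old_edges H S e -> (H `|` S) (src e).
Proof. by case=> [He|[Se _]]; [left|right]. Qed.

Lemma porc_old_rng H S e :
  hereditary H -> porc_old_edges H S e -> (H `|` S) (rng e).
Proof.
move=> hH [He|[_ He]]; left => //.
pose p : nepath := exist (fun p => path _ p.1 p.2) (e, [::]) isT.
exact: (hH (EdgePath p) He).
Qed.

Lemma porc_new_rng1 H S e (pe : path (fun e f => rng e == src f) e [::]) :
  porc_F H S (exist _ (e, [::]) pe) -> (H `|` S) (rng e).
Proof. by case=> [[He _]|Se]; [left|right]. Qed.

Lemma nepath_tail e f (s : seq (edge E)) :
  path (fun e f => rng e == src f) e (f :: s) ->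
  path (fun e f => rng e == src f) f s.
Proof. by case/andP. Qed.

Lemma porc_new_rng2 H S e f s
    (p : path (fun e f => rng e == src f) e (f :: s)) :
  porc_F H S (exist _ (e, f :: s) p) ->
  porc_F H S (exist _ (f, s) (nepath_tail p)).
Proof. by []. Qed.

Definition porc_src H S (x : porc_edge H S) : porc_vertex H S :=
  match x with
  | inl (exist e he) => inl (exist _ (src e) (mem_set (porc_old_src (set_mem he))))
  | inr p => inr p
  end.

(* r(f^e) = r(e) and r(f^{eq}) = w^q. *)
Definition porc_rng H S (hH : hereditary H) (x : porc_edge H S)
    : porc_vertex H S :=
  match x with
  | inl (exist e he) =>
      inl (exist _ (rng e) (mem_set (porc_old_rng hH (set_mem he))))
  | inr (exist (exist (e, [::]) pe) hp) =>
      inl (exist _ (rng e) (mem_set (porc_new_rng1 (set_mem hp))))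
  | inr (exist (exist (e, f :: s) pe) hp) =>
      inr (exist _ (exist _ (f, s) (nepath_tail pe))
             (mem_set (porc_new_rng2 (set_mem hp))))
  end.

Definition porcupine H S (adm : admissible_pair H S) : digraph :=
  {| vertex := porc_vertex H S;
     edge := porc_edge H S;
     src := @porc_src H S;
     rng := @porc_rng H S (adm_hereditary adm) |}.

End Graphs.

Section Leavitt.
Variables (K : fieldType) (E : digraph).

Inductive lterm :=
| LVert of vertex E
| LEdge of edge E
| LGhost of edge E
| LZero
| LAdd of lterm & lterm
| LScale of K & lterm
| LMul of lterm & lterm.

HB.instance Definition _ := gen_eqMixin lterm.
HB.instance Definition _ := gen_choiceMixin lterm.

(* The least congruence on formal expressions containing the axioms of an
   associative K-algebra (opposites are given by -1 *: x) and the relations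
   (V), (E1), (E2), (CK1), (CK2). *)
Inductive lcong : lterm -> lterm -> Prop :=
| lcong_refl x : lcong x x
| lcong_sym x y : lcong x y -> lcong y x
| lcong_trans x y z : lcong x y -> lcong y z -> lcong x z
| lcong_add x x' y y' : lcong x x' -> lcong y y' -> lcong (LAdd x y) (LAdd x' y')
| lcong_scale k x x' : lcong x x' -> lcong (LScale k x) (LScale k x')
| lcong_mul x x' y y' : lcong x x' -> lcong y y' -> lcong (LMul x y) (LMul x' y')
| lcong_addA x y z : lcong (LAdd x (LAdd y z)) (LAdd (LAdd x y) z)
| lcong_addC x y : lcong (LAdd x y) (LAdd y x)
| lcong_add0 x : lcong (LAdd LZero x) x
| lcong_scale0 x : lcong (LScale 0 x) LZero
| lcong_scale1 x : lcong (LScale 1 x) x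
| lcong_scaleA k l x : lcong (LScale k (LScale l x)) (LScale (k * l) x)
| lcong_scaleDr k x y :
    lcong (LScale k (LAdd x y)) (LAdd (LScale k x) (LScale k y))
| lcong_scaleDl k l x :
    lcong (LScale (k + l) x) (LAdd (LScale k x) (LScale l x))
| lcong_mulA x y z : lcong (LMul x (LMul y z)) (LMul (LMul x y) z)
| lcong_mulDl x y z : lcong (LMul (LAdd x y) z) (LAdd (LMul x z) (LMul y z))
| lcong_mulDr x y z : lcong (LMul x (LAdd y z)) (LAdd (LMul x y) (LMul x z))
| lcong_mulZl k x y : lcong (LMul (LScale k x) y) (LScale k (LMul x y))
| lcong_mulZr k x y : lcong (LMul x (LScale k y)) (LScale k (LMul x y))
| lcong_V0 v w : v <> w -> lcong (LMul (LVert v) (LVert w)) LZero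
| lcong_V1 v : lcong (LMul (LVert v) (LVert v)) (LVert v)
| lcong_E1s e : lcong (LMul (LVert (src e)) (LEdge e)) (LEdge e)
| lcong_E1r e : lcong (LMul (LEdge e) (LVert (rng e))) (LEdge e)
| lcong_E2r e : lcong (LMul (LVert (rng e)) (LGhost e)) (LGhost e)
| lcong_E2s e : lcong (LMul (LGhost e) (LVert (src e))) (LGhost e)
| lcong_CK10 e f : e <> f -> lcong (LMul (LGhost e) (LEdge f)) LZero
| lcong_CK11 e : lcong (LMul (LGhost e) (LEdge e)) (LVert (rng e))
| lcong_CK2 v : regular v ->
    lcong (LVert v)
        (\big[LAdd/LZero]_(e <- fset_set (out_edges v))
            LMul (LEdge e) (LGhost e)).

Definition lcongb : rel lterm := fun x y => `[< lcong x y >].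

Lemma lcongb_equiv : equiv_class_of lcongb.
Proof.
split.
- by move=> x; apply/asboolP; exact: lcong_refl.
- by move=> x y; apply/asboolP/asboolP; exact: lcong_sym.
- by move=> y x z /asboolP xy /asboolP yz; apply/asboolP; exact: lcong_trans xy yz.
Qed.

Canonical lcongb_equivRel := EquivRelPack lcongb_equiv.

Definition lpa : Type := {eq_quot lcongb}.
HB.instance Definition _ := Choice.on lpa.
HB.instance Definition _ := EqQuotient.on lpa.

Lemma lpa_eqP x y : \pi_lpa x = \pi_lpa y <-> lcong x y.
Proof.
split; first by move/eqmodP => /asboolP.
by move=> h; apply/eqmodP; apply/asboolP.
Qed.

Lemma lcong_repr x : lcong (repr (\pi_lpa x)) x.
Proof. by apply/lpa_eqP; rewrite reprK. Qed.

Definition lpa_zero : lpa := \pi_lpa LZero.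
Definition lpa_add : lpa -> lpa -> lpa := lift_op2 lpa LAdd.
Definition lpa_scale (k : K) : lpa -> lpa := lift_op1 lpa (LScale k).
Definition lpa_opp (x : lpa) : lpa := lpa_scale (-1) x.
Definition lpa_mul : lpa -> lpa -> lpa := lift_op2 lpa LMul.

Lemma lpa_addE x y : lpa_add (\pi_lpa x) (\pi_lpa y) = \pi_lpa (LAdd x y).
Proof.
by unlock lpa_add; apply/lpa_eqP; apply: lcong_add; exact: lcong_repr.
Qed.

Lemma lpa_scaleE k x : lpa_scale k (\pi_lpa x) = \pi_lpa (LScale k x).
Proof.
by unlock lpa_scale; apply/lpa_eqP; apply: lcong_scale; exact: lcong_repr.
Qed.

Lemma lpa_mulE x y : lpa_mul (\pi_lpa x) (\pi_lpa y) = \pi_lpa (LMul x y).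
Proof.
by unlock lpa_mul; apply/lpa_eqP; apply: lcong_mul; exact: lcong_repr.
Qed.

Let lpaE := (lpa_addE, lpa_scaleE, lpa_mulE).

Lemma lpa_addA : associative lpa_add.
Proof.
elim/quotW => x; elim/quotW => y; elim/quotW => z.
by rewrite !lpaE; apply/lpa_eqP; exact: lcong_addA.
Qed.

Lemma lpa_addC : commutative lpa_add.
Proof.
elim/quotW => x; elim/quotW => y.
by rewrite !lpaE; apply/lpa_eqP; exact: lcong_addC.
Qed.

Lemma lpa_add0 : left_id lpa_zero lpa_add.
Proof. by elim/quotW => x; rewrite !lpaE; apply/lpa_eqP; exact: lcong_add0. Qed.

Lemma lpa_scale1 : left_id 1 lpa_scale.
Proof. by elim/quotW => x; rewrite !lpaE; apply/lpa_eqP; exact: lcong_scale1. Qed.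

Lemma lpa_scaleA k l x : lpa_scale k (lpa_scale l x) = lpa_scale (k * l) x.
Proof.
by elim/quotW: x => x; rewrite !lpaE; apply/lpa_eqP; exact: lcong_scaleA.
Qed.

Lemma lpa_scaleDr : right_distributive lpa_scale lpa_add.
Proof.
move=> k; elim/quotW => x; elim/quotW => y.
by rewrite !lpaE; apply/lpa_eqP; exact: lcong_scaleDr.
Qed.

Lemma lpa_scaleDl x : {morph lpa_scale^~ x : k l / k + l >-> lpa_add k l}.
Proof.
by elim/quotW: x => x k l; rewrite !lpaE; apply/lpa_eqP; exact: lcong_scaleDl.
Qed.

Lemma lpa_addN : left_inverse lpa_zero lpa_opp lpa_add.
Proof.
move=> x; rewrite /lpa_opp -[X in lpa_add _ X]lpa_scale1 -lpa_scaleDl addNr.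
by elim/quotW: x => x; rewrite !lpaE; apply/lpa_eqP; exact: lcong_scale0.
Qed.

HB.instance Definition _ :=
  GRing.isZmodule.Build lpa lpa_addA lpa_addC lpa_add0 lpa_addN.
HB.instance Definition _ :=
  GRing.Zmodule_isLmodule.Build K lpa lpa_scaleA lpa_scale1 lpa_scaleDr
    lpa_scaleDl.

Lemma lpa_mulA : associative lpa_mul.
Proof.
elim/quotW => x; elim/quotW => y; elim/quotW => z.
by rewrite !lpaE; apply/lpa_eqP; exact: lcong_mulA.
Qed.

Lemma lpa_mulDl : left_distributive lpa_mul +%R.
Proof.
elim/quotW => x; elim/quotW => y; elim/quotW => z.
rewrite -![_ + _]/(lpa_add _ _) !lpaE; apply/lpa_eqP; exact: lcong_mulDl.
Qed.

Lemma lpa_mulDr : right_distributive lpa_mul +%R.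
Proof.
elim/quotW => x; elim/quotW => y; elim/quotW => z.
rewrite -![_ + _]/(lpa_add _ _) !lpaE; apply/lpa_eqP; exact: lcong_mulDr.
Qed.

Lemma lpa_mulZl k (x y : lpa) : lpa_mul (k *: x) y = k *: lpa_mul x y.
Proof.
elim/quotW: x => x; elim/quotW: y => y.
rewrite -![_ *: _]/(lpa_scale _ _) !lpaE; apply/lpa_eqP; exact: lcong_mulZl.
Qed.

Lemma lpa_mulZr k (x y : lpa) : lpa_mul x (k *: y) = k *: lpa_mul x y.
Proof.
elim/quotW: x => x; elim/quotW: y => y.
rewrite -![_ *: _]/(lpa_scale _ _) !lpaE; apply/lpa_eqP; exact: lcong_mulZr.
Qed.

HB.instance Definition _ :=
  Lmodule_isNonUnitalAlgebra.Build K lpa lpa_mulA lpa_mulDl lpa_mulDr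
    lpa_mulZl lpa_mulZr.

Definition lvert (v : vertex E) : lpa := \pi_lpa (LVert v).
Definition ledge (e : edge E) : lpa := \pi_lpa (LEdge e).
Definition lghost (e : edge E) : lpa := \pi_lpa (LGhost e).

Definition lpath (p : gpath E) : lpa :=
  match p with
  | VertexPath v => lvert v
  | EdgePath q =>
      foldl (fun x e => x ** ledge e) (ledge (val q).1) (val q).2
  end.

Definition lpath_star (p : gpath E) : lpa :=
  match p with
  | VertexPath v => lvert v
  | EdgePath q =>
      foldl (fun x e => lghost e ** x) (lghost (val q).1) (val q).2
  end.

Definition lpa_comp (n : int) : set lpa :=
  lin_span [set x | exists p q : gpath E,
    (plen p)%:Z - (plen q)%:Z = n /\ x = lpath p ** lpath_star q].

(* The sum of the components I `&` lpa_comp n is automatically direct, since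
   that of the lpa_comp n is. *)
Definition graded_ideal (I : set lpa) : Prop :=
  two_sided_ideal I /\
  forall x, I x -> exists (s : seq int) (f : int -> lpa),
    (forall n, (I `&` lpa_comp n) (f n)) /\ x = \sum_(n <- s) f n.

(* v^H = v - sum of the e e^*; the index set is finite for v in B_H. *)
Definition vH (H : set (vertex E)) (v : vertex E) : lpa :=
  lvert v - \sum_(e \in out_edges v `&` in_edges_of (~` H))
              ledge e ** lghost e.

Definition ideal_HS (H S : set (vertex E)) : set lpa :=
  ideal_gen (lvert @` H `|` vH H @` S).

Variable kstar : {rmorphism K -> K}.

Fixpoint lstar (x : lterm) : lterm :=
  match x with
  | LVert v => LVert v
  | LEdge e => LGhost e
  | LGhost e => LEdge e
  | LZero => LZero
  | LAdd x y => LAdd (lstar x) (lstar y)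
  | LScale k x => LScale (kstar k) (lstar x)
  | LMul x y => LMul (lstar y) (lstar x)
  end.

Lemma lcong_lstar x y : lcong x y -> lcong (lstar x) (lstar y).
Proof.
elim=> //=; try by move=> *; econstructor; eauto.
- by move=> *; rewrite rmorph0; exact: lcong_scale0.
- by move=> *; rewrite rmorph1; exact: lcong_scale1.
- by move=> *; rewrite rmorphM; exact: lcong_scaleA.
- by move=> *; rewrite rmorphD; exact: lcong_scaleDl.
- by move=> *; apply: lcong_sym; exact: lcong_mulA.
- move=> v rv; apply: lcong_trans (lcong_CK2 rv) _.
  have -> : forall r : seq (edge E),
      lstar (\big[LAdd/LZero]_(e <- r) LMul (LEdge e) (LGhost e)) =
      \big[LAdd/LZero]_(e <- r) LMul (LEdge e) (LGhost e).
    by elim=> [|e r IHr]; rewrite !(big_nil, big_cons) //= IHr.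
  exact: lcong_refl.
Qed.

Definition lpa_star : lpa -> lpa := lift_op1 lpa lstar.

Lemma lpa_starE x : lpa_star (\pi_lpa x) = \pi_lpa (lstar x).
Proof.
by unlock lpa_star; apply/lpa_eqP; apply: lcong_lstar; exact: lcong_repr.
Qed.

Lemma lpa_starD x y : lpa_star (x + y) = lpa_star x + lpa_star y.
Proof.
elim/quotW: x => x; elim/quotW: y => y.
by rewrite -![_ + _]/(lpa_add _ _) !lpa_starE !lpa_addE lpa_starE.
Qed.

Lemma lpa_starZ k x : lpa_star (k *: x) = kstar k *: lpa_star x.
Proof.
elim/quotW: x => x.
by rewrite -![_ *: _]/(lpa_scale _ _) !lpa_starE !lpa_scaleE lpa_starE.
Qed.

Lemma lpa_starM x y : lpa_star (x ** y) = lpa_star y ** lpa_star x.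
Proof.
elim/quotW: x => x; elim/quotW: y => y.
by rewrite -![_ ** _]/(lpa_mul _ _) !lpa_starE !lpa_mulE lpa_starE.
Qed.

Lemma lpa_star_path p : lpa_star (lpath p) = lpath_star p.
Proof.
case: p => [v|[[e s] ps]] /=; first exact: lpa_starE.
have : lpa_star (ledge e) = lghost e by exact: lpa_starE.
elim: s (ledge e) (lghost e) {ps} => [|f s IHs] //= x y xy.
by apply: IHs; rewrite lpa_starM xy lpa_starE.
Qed.

Lemma lpa_star_ghost_path p : lpa_star (lpath_star p) = lpath p.
Proof.
case: p => [v|[[e s] ps]] /=; first exact: lpa_starE.
have : lpa_star (lghost e) = ledge e by exact: lpa_starE.
elim: s (ledge e) (lghost e) {ps} => [|f s IHs] //= x y xy.
by apply: IHs; rewrite lpa_starM xy lpa_starE.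
Qed.

Lemma lpa_star_sum (s : seq (K * (gpath E * gpath E))) :
  lpa_star (\sum_(c <- s) c.1 *: (lpath c.2.1 ** lpath_star c.2.2)) =
  \sum_(c <- s) kstar c.1 *: (lpath c.2.2 ** lpath_star c.2.1).
Proof.
elim/big_rec2: _ => [|c x y _ IH]; first exact: lpa_starE.
by rewrite lpa_starD lpa_starZ lpa_starM lpa_star_path lpa_star_ghost_path IH.
Qed.

End Leavitt.

Arguments lpa_comp {K E} n.
Arguments ideal_HS {K E} H S.

(* An isomorphism onto the ideal I of L_K(E) is given as an injective map into
   L_K(E) with range I; the n-component of I is I `&` lpa_comp n. *)
Definition graded_star_isomorphic (K : fieldType) (kstar : {rmorphism K -> K})
    (F E : digraph) (I : set (lpa K E)) : Prop :=
  exists phi : {linear lpa K F -> lpa K E},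
    [/\ forall x y, phi (x ** y) = phi x ** phi y,
        injective phi,
        range phi = I,
        forall n : int, phi @` lpa_comp n `<=` I `&` lpa_comp n
      & forall x, phi (lpa_star kstar x) = lpa_star kstar (phi x)].

(* Main.v *)
Require Import Defs.
From HB Require Import structures.
From mathcomp Require Import all_boot all_order all_algebra.
From mathcomp Require Import generic_quotient finmap.
From mathcomp Require Import all_classical.

(** Write [P] for the porcupine graph of [(H, S)]. There is a map of graphs from
    [P] to [E], identity on the old part, that sends the new vertex [w^p] to the
    source of [p] and the new edge [f^p] to the first edge of [p]. It is a
    covering in one direction ([porc_covering]): an edge [e] of [E] and a vertex
    of [P] above its range determine a unique edge of [P] above [e].

    Two maps result. First, each vertex [w] of [P] has a projection in [lpa K E]:
    [v] for [v] in [H], [v^H] for [v] in [S], and [p x p^*] for [w^p], where [x]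
    is the projection of the range of [p]. Sending [w] to its projection and an
    edge [h] above [e] to [e] times the projection of the range of [h] defines a
    graded *-homomorphism [phi] from [lpa K P] to [lpa K E]. Secondly, [lpa K E]
    acts on [lpa K P] by right module maps ([cov_act_exists]): [e] acts as the
    sum, finite on each element, of the edges of [P] above it.

    These maps satisfy [phi (x . a) = x phi(a)] ([lift_hom_cov_act]) and
    [phi(b) . a = b a] ([cov_act_lift_hom]). The second identity makes [phi]
    injective, without any appeal to the graded uniqueness theorem, since
    [lpa K P] has local units. The first makes the range of [phi] a left ideal,
    hence, by the involution, an ideal; so the range is the ideal generated by
    the projections, which is [ideal_HS H S] ([porc_proj_ideal]).

    It remains to see that a graded ideal [I] is some [ideal_HS H S]
    ([graded_ideal_HS]). Take for [H] the vertices in [I] and for [S] the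
    breaking vertices [v] with [v^H] in [I]. A homogeneous [x] in [I] of
    positive degree is a finite sum of [e (e^* x)], negative degrees follow by the
    involution, and in degree zero one argues by induction on the length of the
    paths that occur ([core_ideal]): the vertices occurring in [x] can be replaced
    by elements of [ideal_HS H S], up to terms [e m f^*] ([vertex_part]), and an
    element of [I] made of such terms is the sum of the [e (e^* x f) f^*] with
    [e^* x f] in [I] and involving shorter paths. *)

Set Implicit Arguments.
Unset Strict Implicit.
Unset Printing Implicit Defensive.

Import GRing.Theory.

Local Open Scope classical_set_scope.
Local Open Scope ring_scope.
Local Open Scope quotient_scope.

(** * Non-unital algebras, ideals and linear spans *)

Section NonUnitalAlgebra.
Variables (K : fieldType) (A : nonUnitalAlgType K).
Implicit Types x y z : A.

Lemma numull_is_linear x : linear (numul x).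
Proof. by move=> k y z; rewrite numulDr numulZr. Qed.

HB.instance Definition _ x :=
  GRing.isLinear.Build K A A *:%R (numul x) (numull_is_linear x).

Definition numulr y x := x ** y.

Lemma numulr_is_linear y : linear (numulr y).
Proof. by move=> k x z; rewrite /numulr numulDl numulZl. Qed.

HB.instance Definition _ y :=
  GRing.isLinear.Build K A A *:%R (numulr y) (numulr_is_linear y).

Lemma numul0l x : 0 ** x = 0. Proof. exact: (linear0 (numulr x)). Qed.
Lemma numul0r x : x ** 0 = 0. Proof. exact: linear0. Qed.
Lemma numulBr x y z : x ** (y - z) = x ** y - x ** z.
Proof. exact: linearB. Qed.

Lemma numul_suml I (r : seq I) (F : I -> A) x :
  (\sum_(i <- r) F i) ** x = \sum_(i <- r) F i ** x.
Proof. exact: (linear_sum (numulr x)). Qed.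

Lemma numul_sumr I (r : seq I) (F : I -> A) x :
  x ** (\sum_(i <- r) F i) = \sum_(i <- r) x ** F i.
Proof. exact: linear_sum. Qed.

Lemma ideal_sum (J : set A) I (r : seq I) (F : I -> A) : two_sided_ideal J ->
  (forall i, J (F i)) -> J (\sum_(i <- r) F i).
Proof.
by move=> hJ JF; apply: big_rec => [|i x _]; [exact: ideal0|exact: idealD].
Qed.

Lemma idealB (J : set A) x y : two_sided_ideal J -> J x -> J y -> J (x - y).
Proof.
by move=> hJ Jx Jy; apply: idealD => //; rewrite -scaleN1r; exact: idealZ.
Qed.

Lemma ideal_gen_ideal (G : set A) : two_sided_ideal (ideal_gen G).
Proof.
split=> [I [hI _]|x y Ix Iy I hI|k x Ix I hI|a x Ix I hI|a x Ix I hI].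
- exact: ideal0.
- by case: (hI) => h _; apply: idealD => //; [exact: Ix|exact: Iy].
- by case: (hI) => h _; apply: idealZ => //; exact: Ix.
- by case: (hI) => h _; apply: idealMl => //; exact: Ix.
- by case: (hI) => h _; apply: Defs.idealMr => //; exact: Ix.
Qed.

End NonUnitalAlgebra.

Section LinSpan.
Variables (K : fieldType) (V : lmodType K).
Implicit Types G : set V.

Lemma lin_span_gen G x : G x -> lin_span G x.
Proof.
move=> Gx; exists [:: (1, x)]; split=> [c|]; first by rewrite inE => /eqP ->.
by rewrite big_seq1 scale1r.
Qed.

Lemma lin_span0 G : lin_span G 0.
Proof. by exists [::]; rewrite big_nil. Qed.

Lemma lin_spanD G x y : lin_span G x -> lin_span G y -> lin_span G (x + y).
Proof.
move=> [s [sG ->]] [t [tG ->]]; exists (s ++ t); rewrite big_cat; split=> // c.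
by rewrite mem_cat => /orP[/sG|/tG].
Qed.

Lemma lin_spanZ G k x : lin_span G x -> lin_span G (k *: x).
Proof.
move=> [s [sG ->]]; exists [seq (k * c.1, c.2) | c <- s]; split.
  by move=> c /mapP[d /sG Gd ->].
by rewrite big_map scaler_sumr; apply: eq_bigr => c _ /=; rewrite scalerA.
Qed.

Lemma lin_spanN G x : lin_span G x -> lin_span G (- x).
Proof. by move=> ?; rewrite -scaleN1r; exact: lin_spanZ. Qed.

Lemma lin_span_ind G (C : V -> Prop) :
  C 0 -> (forall x y, C x -> C y -> C (x + y)) ->
  (forall k x, C x -> C (k *: x)) -> (forall x, G x -> C x) ->
  forall x, lin_span G x -> C x.
Proof.
move=> C0 CD CZ CG x [s [sG ->]]; rewrite big_seq.
by apply: big_ind => // c /sG Gc; apply/CZ/CG.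
Qed.

Lemma lin_span_sum G I (r : seq I) (F : I -> V) :
  (forall i, lin_span G (F i)) -> lin_span G (\sum_(i <- r) F i).
Proof.
by move=> FG; apply: big_rec => [|i x _]; [exact: lin_span0|exact: lin_spanD].
Qed.

End LinSpan.

Lemma lin_span_map (K : fieldType) (V W : lmodType K) (f : {linear V -> W})
    (G : set V) (G' : set W) :
  (forall x, G x -> lin_span G' (f x)) ->
  forall x, lin_span G x -> lin_span G' (f x).
Proof.
move=> fG; apply: lin_span_ind => // [|x y|k x].
- by rewrite linear0; exact: lin_span0.
- by rewrite linearD; exact: lin_spanD.
- by rewrite linearZ; exact: lin_spanZ.
Qed.

(** * Relations, induction and maps out of a Leavitt path algebra *)

Section Relations.
Variables (K : fieldType) (E : digraph).
Notation L := (lpa K E).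
Implicit Types (v w : vertex E) (e f : edge E) (x y : L).

Lemma lpa_piD (x y : lterm K E) : \pi_L (LAdd x y) = \pi_L x + \pi_L y :> L.
Proof. by rewrite -lpa_addE. Qed.
Lemma lpa_piZ k (x : lterm K E) : \pi_L (LScale k x) = k *: \pi_L x :> L.
Proof. by rewrite -lpa_scaleE. Qed.
Lemma lpa_piM (x y : lterm K E) : \pi_L (LMul x y) = \pi_L x ** \pi_L y :> L.
Proof. by rewrite -lpa_mulE. Qed.

Lemma lvert_mul v w :
  lvert K v ** lvert K w = if v == w then lvert K v else 0.
Proof.
rewrite -lpa_piM; case: eqP => [->|vw].
  by apply/lpa_eqP; exact: lcong_V1.
by rewrite -[RHS]/(\pi_L (LZero K E)); apply/lpa_eqP; exact: lcong_V0.
Qed.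

Lemma lvertK v : lvert K v ** lvert K v = lvert K v.
Proof. by rewrite lvert_mul eqxx. Qed.
Lemma lvert_src e : lvert K (src e) ** ledge K e = ledge K e.
Proof. by rewrite -lpa_piM; apply/lpa_eqP; exact: lcong_E1s. Qed.
Lemma ledge_rng e : ledge K e ** lvert K (rng e) = ledge K e.
Proof. by rewrite -lpa_piM; apply/lpa_eqP; exact: lcong_E1r. Qed.
Lemma lvert_rng e : lvert K (rng e) ** lghost K e = lghost K e.
Proof. by rewrite -lpa_piM; apply/lpa_eqP; exact: lcong_E2r. Qed.
Lemma lghost_src e : lghost K e ** lvert K (src e) = lghost K e.
Proof. by rewrite -lpa_piM; apply/lpa_eqP; exact: lcong_E2s. Qed.

Lemma lghost_edge e f :
  lghost K e ** ledge K f = if e == f then lvert K (rng e) else 0.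
Proof.
rewrite -lpa_piM; case: eqP => [<-|ef].
  by apply/lpa_eqP; exact: lcong_CK11.
by rewrite -[RHS]/(\pi_L (LZero K E)); apply/lpa_eqP; exact: lcong_CK10.
Qed.

Lemma lvert_edge v e :
  lvert K v ** ledge K e = if v == src e then ledge K e else 0.
Proof.
rewrite -{1}lvert_src numulA lvert_mul.
by case: eqP => [->|_]; rewrite ?lvert_src ?numul0l.
Qed.

Lemma ledge_vert e v :
  ledge K e ** lvert K v = if rng e == v then ledge K e else 0.
Proof.
rewrite -{1}ledge_rng -numulA lvert_mul.
by case: eqP => [_|_]; rewrite ?ledge_rng ?numul0r.
Qed.

Lemma lghost_vert e v :
  lghost K e ** lvert K v = if src e == v then lghost K e else 0.
Proof.
rewrite -{1}lghost_src -numulA lvert_mul.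
by case: eqP => [_|_]; rewrite ?lghost_src ?numul0r.
Qed.

Lemma lpa_pi_sum (r : seq (edge E)) (F : edge E -> lterm K E) :
  \pi_L (\big[@LAdd K E/LZero K E]_(e <- r) F e)
  = \sum_(e <- r) \pi_L (F e) :> L.
Proof.
by elim: r => [|e r IH]; rewrite ?(big_nil, big_cons) // lpa_piD IH.
Qed.

Lemma lvert_CK2 v : regular v ->
  lvert K v = \sum_(e <- fset_set (out_edges v)) ledge K e ** lghost K e.
Proof.
move=> rv; under eq_bigr do rewrite -lpa_piM; rewrite -lpa_pi_sum.
by apply/lpa_eqP; exact: lcong_CK2.
Qed.

Lemma lpa_ind (C : L -> Prop) :
  C 0 -> (forall x y, C x -> C y -> C (x + y)) ->
  (forall k x, C x -> C (k *: x)) ->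
  (forall x y, C x -> C y -> C (x ** y)) ->
  (forall v, C (lvert K v)) -> (forall e, C (ledge K e)) ->
  (forall e, C (lghost K e)) -> forall x, C x.
Proof.
move=> C0 CD CZ CM Cv Ce Cg; elim/quotW.
elim=> [v|e|e||x Cx y Cy|k x Cx|x Cx y Cy]; rewrite ?(lpa_piD, lpa_piZ, lpa_piM);
  by [exact: Cv|exact: Ce|exact: Cg|exact: C0|exact: CD|exact: CZ|exact: CM].
Qed.

(** The universal property is proved for a product [mul] that is linear in its
    right argument only when the left one is in a subset [D] stable under the
    operations. The case [D = setT] gives algebra morphisms. Representations
    are obtained with composition of functions as product, which is additive on
    the right only for an additive left factor, and right module maps as [D]. *)

Section Evaluation.
Variables (V : lmodType K) (mul : V -> V -> V) (D : set V).
Hypotheses (mulA : associative mul) (mulDl : left_distributive mul +%R)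
  (mulZl : forall k (x y : V), mul (k *: x) y = k *: mul x y)
  (mulDr : forall x y z : V, D x -> mul x (y + z) = mul x y + mul x z)
  (mulZr : forall k (x y : V), D x -> mul x (k *: y) = k *: mul x y).
Hypotheses (D0 : D 0) (DD : forall x y : V, D x -> D y -> D (x + y))
  (DZ : forall k (x : V), D x -> D (k *: x))
  (DM : forall x y : V, D x -> D y -> D (mul x y)).
Variables (gv : vertex E -> V) (ge gg : edge E -> V).
Hypotheses (Dv : forall v, D (gv v)) (De : forall e, D (ge e))
  (Dg : forall e, D (gg e)).
Hypotheses (relV : forall v w, mul (gv v) (gv w) = if v == w then gv v else 0)
  (relE1s : forall e, mul (gv (src e)) (ge e) = ge e)
  (relE1r : forall e, mul (ge e) (gv (rng e)) = ge e)
  (relE2r : forall e, mul (gv (rng e)) (gg e) = gg e)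
  (relE2s : forall e, mul (gg e) (gv (src e)) = gg e)
  (relCK1 : forall e f, mul (gg e) (ge f) = if e == f then gv (rng e) else 0)
  (relCK2 : forall v, regular v ->
     gv v = \sum_(e <- fset_set (out_edges v)) mul (ge e) (gg e)).

Fixpoint leval (x : lterm K E) : V :=
  match x with
  | LVert v => gv v
  | LEdge e => ge e
  | LGhost e => gg e
  | LZero => 0
  | LAdd x y => leval x + leval y
  | LScale k x => k *: leval x
  | LMul x y => mul (leval x) (leval y)
  end.

Lemma leval_closed (x : lterm K E) : D (leval x).
Proof. by elim: x => //= *; [exact: DD|exact: DZ|exact: DM]. Qed.

Lemma leval_cong (x y : lterm K E) : lcong x y -> leval x = leval y.
Proof.
elim=> {x y} //=.
- by move=> x y z _ -> _ ->.
- by move=> x x' y y' _ -> _ ->.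
- by move=> k x x' _ ->.
- by move=> x x' y y' _ -> _ ->.
- by move=> x y z; rewrite addrA.
- by move=> x y; rewrite addrC.
- by move=> x; rewrite add0r.
- by move=> x; rewrite scale0r.
- by move=> x; rewrite scale1r.
- by move=> k l x; rewrite scalerA.
- by move=> k x y; rewrite scalerDr.
- by move=> k l x; rewrite scalerDl.
- by move=> x y z; rewrite mulDr //; exact: leval_closed.
- by move=> k x y; rewrite mulZr //; exact: leval_closed.
- by move=> v w vw; rewrite relV; case: eqP.
- by move=> v; rewrite relV eqxx.
- by move=> e f ef; rewrite relCK1; case: eqP.
- by move=> e; rewrite relCK1 eqxx.
- move=> v rv; rewrite (relCK2 rv).
  by elim: (fset_set _ : seq _) => [|e r IH];
    rewrite ?(big_nil, big_cons) //= IH.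
Qed.

Lemma lpa_eval_exists : exists f : L -> V,
  [/\ forall k x y, f (k *: x + y) = k *: f x + f y,
      forall x y, f (x ** y) = mul (f x) (f y),
      forall x, D (f x) &
      [/\ forall v, f (lvert K v) = gv v, forall e, f (ledge K e) = ge e &
          forall e, f (lghost K e) = gg e]].
Proof.
pose f (x : L) := leval (repr x).
have fE (x : lterm K E) : f (\pi_L x) = leval x by apply: leval_cong; exact: lcong_repr.
exists f; split=> [k|||]; last by split=> v; exact: fE.
- elim/quotW=> x; elim/quotW=> y; by rewrite -lpa_piZ -lpa_piD !fE.
- elim/quotW=> x; elim/quotW=> y; by rewrite -lpa_piM !fE.
- by move=> x; exact: leval_closed.
Qed.

End Evaluation.

(** As a right module over itself the algebra is the direct sum of the [v L],
    [v] a vertex. Hence a right module endomorphism is the free choice, for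
    each [v], of an element [t v] with [t v ** v = t v]. *)

Section RightModuleMap.
Variable t : vertex E -> L.
Hypothesis tK : forall v, t v ** lvert K v = t v.

Fixpoint rmap_term (x : lterm K E) : L :=
  match x with
  | LVert v => t v
  | LEdge e => t (src e) ** ledge K e
  | LGhost e => t (rng e) ** lghost K e
  | LZero => 0
  | LAdd x y => rmap_term x + rmap_term y
  | LScale k x => k *: rmap_term x
  | LMul x y => rmap_term x ** \pi_L y
  end.

Lemma rmap_term_cong (x y : lterm K E) : lcong x y -> rmap_term x = rmap_term y.
Proof.
elim=> {x y} //=.
- by move=> x y z _ -> _ ->.
- by move=> x x' y y' _ -> _ ->.
- by move=> k x x' _ ->.
- by move=> x x' y y' _ -> /lpa_eqP ->.
- by move=> x y z; rewrite addrA.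
- by move=> x y; rewrite addrC.
- by move=> x; rewrite add0r.
- by move=> x; rewrite scale0r.
- by move=> x; rewrite scale1r.
- by move=> k l x; rewrite scalerA.
- by move=> k x y; rewrite scalerDr.
- by move=> k l x; rewrite scalerDl.
- by move=> x y z; rewrite lpa_piM numulA.
- by move=> x y z; rewrite numulDl.
- by move=> x y z; rewrite lpa_piD numulDr.
- by move=> k x y; rewrite numulZl.
- by move=> k x y; rewrite lpa_piZ numulZr.
- move=> v w vw; rewrite -tK -numulA lvert_mul; case: eqP => // _.
  by rewrite numul0r.
- by move=> e; rewrite -numulA ledge_rng.
- by move=> e; rewrite -numulA lghost_src.
- by move=> e f ef; rewrite -numulA lghost_edge; case: eqP => // _; rewrite numul0r.
- by move=> e; rewrite -numulA lghost_edge eqxx tK.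
- move=> v rv; transitivity (\sum_(e <- fset_set (out_edges v))
    t v ** (ledge K e ** lghost K e)).
    by rewrite -numul_sumr -lvert_CK2 ?tK.
  have : {in (fset_set (out_edges v) : seq _), forall e, src e = v}.
    have [_ /contrapT fv] := rv; move=> e.
    by rewrite in_fset_set // inE.
  elim: (fset_set _ : seq _) => [|e r IH] rP; rewrite ?(big_nil, big_cons) //=.
  rewrite rP ?inE ?eqxx // IH ?numulA // => f fr; apply: rP.
  by rewrite inE fr orbT.
Qed.

Lemma lpa_rmap_exists : exists f : L -> L,
  [/\ forall k x y, f (k *: x + y) = k *: f x + f y,
      forall x y, f (x ** y) = f x ** y &
      forall v, f (lvert K v) = t v].
Proof.
pose f (x : L) := rmap_term (repr x).
have fE (x : lterm K E) : f (\pi_L x) = rmap_term x.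
  by apply: rmap_term_cong; exact: lcong_repr.
exists f; split=> [k||v]; last exact: fE.
- elim/quotW=> x; elim/quotW=> y; by rewrite -lpa_piZ -lpa_piD !fE.
- elim/quotW=> x; elim/quotW=> y; by rewrite -lpa_piM !fE.
Qed.

End RightModuleMap.
End Relations.

(** * Paths and the grading *)

Section FiniteSupport.
Variables (K : fieldType) (V : lmodType K) (I : eqType).
Variable T : I -> {linear V -> V}.

(** Quantifying over all lists that contain [s], instead of [s] alone, makes
    the property stable under sums: two elements can share a larger list. *)
Definition finitely_supported (x : V) :=
  exists s : seq I, forall r, uniq r -> {subset s <= r} ->
    x = \sum_(i <- r) T i x.

Lemma finitely_supported0 : finitely_supported 0.
Proof. by exists [::] => r _ _; rewrite big1 // => i _; rewrite linear0. Qed.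

Lemma finitely_supportedD x y :
  finitely_supported x -> finitely_supported y -> finitely_supported (x + y).
Proof.
move=> [s sx] [t ty]; exists (s ++ t) => r ur st.
under eq_bigr do rewrite linearD; rewrite big_split; congr (_ + _).
- by apply: sx => // i si; apply: st; rewrite mem_cat si.
- by apply: ty => // i ti; apply: st; rewrite mem_cat ti orbT.
Qed.

Lemma finitely_supportedZ k x :
  finitely_supported x -> finitely_supported (k *: x).
Proof.
move=> [s sx]; exists s => r ur sr.
by rewrite {1}(sx r) // scaler_sumr; apply: eq_bigr => i _; rewrite linearZ.
Qed.

Lemma finitely_supported1 i x :
  T i x = x -> (forall j, j != i -> T j x = 0) -> finitely_supported x.
Proof.
move=> Ti Tj; exists [:: i] => r ur ir.
rewrite (bigD1_seq i) ?ir ?inE //= Ti big1 ?addr0 // => j ji; exact: Tj.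
Qed.

Lemma finitely_supportedE x : finitely_supported x ->
  exists2 r : seq I, uniq r & x = \sum_(i <- r) T i x.
Proof.
move=> [s sx]; exists (undup s); first exact: undup_uniq.
by apply: sx => [|i]; rewrite ?undup_uniq ?mem_undup.
Qed.

End FiniteSupport.

Section Paths.
Variables (K : fieldType) (E : digraph).
Notation L := (lpa K E).
Implicit Types (v : vertex E) (e : edge E) (p q : gpath E) (x y : L).

(** Only the values in the algebra of the path [e p] are recorded, so that the
    two encodings of paths (vertices and sequences of edges) are handled
    uniformly. *)
Definition path_cons e p q :=
  [/\ rng e = psrc p, psrc q = src e, prng q = prng p, plen q = (plen p).+1 &
      lpath K q = ledge K e ** lpath K p /\
      lpath_star K q = lpath_star K p ** lghost K e].

Lemma foldl_edge (x y : L) (s : seq (edge E)) :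
  foldl (fun z e => z ** ledge K e) (x ** y) s =
  x ** foldl (fun z e => z ** ledge K e) y s.
Proof. by elim: s y => [|e s IH] y //=; rewrite -numulA IH. Qed.

Lemma foldl_ghost (x y : L) (s : seq (edge E)) :
  foldl (fun z e => lghost K e ** z) (x ** y) s =
  foldl (fun z e => lghost K e ** z) x s ** y.
Proof. by elim: s x => [|e s IH] x //=; rewrite numulA IH. Qed.

Lemma path_cons1 e pe : path_cons e (VertexPath (rng e))
  (EdgePath (exist _ (e, [::]) pe)).
Proof. by split; rewrite //= ledge_rng lvert_rng. Qed.

Lemma path_cons_cons e f s pe pf :
  path_cons e (EdgePath (exist _ (f, s) pf))
    (EdgePath (exist _ (e, f :: s) pe)).
Proof.
split=> //=; first by case/andP: pe => /= /eqP.
by rewrite foldl_edge foldl_ghost.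
Qed.

Lemma path_cons_exists e p : rng e = psrc p -> exists q, path_cons e p q.
Proof.
case: p => [v /= <-|[[f s] ps] /= ef].
  by exists (EdgePath (exist _ (e, [::]) isT)); exact: path_cons1.
have ps' : path (fun e f => rng e == src f) e (f :: s).
  by rewrite /= -/(path _ f s) ps andbT; apply/eqP.
exists (EdgePath (exist _ (e, f :: s) ps')).
exact: path_cons_cons.
Qed.

Lemma gpath_ind_cons (C : gpath E -> Prop) :
  (forall v, C (VertexPath v)) ->
  (forall e p q, path_cons e p q -> C p -> C q) -> forall p, C p.
Proof.
move=> Cv Cc [v|[[e s] ps]]; first exact: Cv.
elim: s e ps => [|f s IH] e ps; first by apply: Cc (path_cons1 _) (Cv _).
by apply: Cc (path_cons_cons _ (nepath_tail ps)) _; exact: IH.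
Qed.

Lemma gpath_caseP p :
  (exists v, p = VertexPath v) \/ exists e q, path_cons e q p.
Proof.
by elim/gpath_ind_cons: p => [v|e p q pq _]; [left; exists v|right; exists e, p].
Qed.

Lemma psrc_lpath p : lvert K (psrc p) ** lpath K p = lpath K p.
Proof.
elim/gpath_ind_cons: p => [v|e p q [_ -> _ _ [-> _]] _]; first exact: lvertK.
by rewrite numulA lvert_src.
Qed.

Lemma prng_lpath_star p :
  lvert K (prng p) ** lpath_star K p = lpath_star K p.
Proof.
elim/gpath_ind_cons: p => [v|e p q [_ _ -> _ [_ ->]] IH]; first exact: lvertK.
by rewrite numulA IH.
Qed.

Lemma path_snoc_exists p e : prng p = src e ->
  exists q, plen q = (plen p).+1 /\
    lpath_star K q = lghost K e ** lpath_star K p.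
Proof.
case: p => [v /= ->|[[f s] ps] /= fe].
  exists (EdgePath (exist _ (e, [::]) isT)); split=> //=.
  by rewrite lghost_src.
have ps' : path (fun e f => rng e == src f) f (rcons s e).
  by rewrite rcons_path ps /=; apply/eqP.
exists (EdgePath (exist _ (f, rcons s e) ps')).
by rewrite /= foldl_rcons size_rcons.
Qed.

Lemma lpa_comp_gen p q n : (plen p)%:Z - (plen q)%:Z = n ->
  lpa_comp n (lpath K p ** lpath_star K q).
Proof. by move=> pqn; apply: lin_span_gen; exists p, q. Qed.

Lemma lpa_comp_edge_mul n e x : lpa_comp n x -> lpa_comp (n + 1) (ledge K e ** x).
Proof.
apply: (lin_span_map (f := numul _)) => _ [p [q [pqn ->]]] /=; rewrite numulA.
have [ep|ep] := eqVneq (rng e) (psrc p).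
  have [p' [_ _ _ lp [<- _]]] := path_cons_exists ep.
  by apply: lpa_comp_gen; rewrite lp -pqn -addn1 PoszD addrAC.
rewrite -psrc_lpath (numulA (ledge K e)) ledge_vert (negPf ep) !numul0l.
exact: lin_span0.
Qed.

(** The delicate case is [e^* v q^*] with [v] a vertex: the ghost edge then
    lengthens [q^*] on the left, that is, it appends [e] at the end of [q]. *)
Lemma lpa_comp_ghost_mul n e x :
  lpa_comp n x -> lpa_comp (n - 1) (lghost K e ** x).
Proof.
apply: (lin_span_map (f := numul _)) => _ [p [q [pqn ->]]] /=; rewrite numulA.
have [[v p_v]|[f [p' [fp' _ _ lp [-> _]]]]] := gpath_caseP p.
  subst p; rewrite /= in pqn *; rewrite lghost_vert.
  case: eqP => [_|_]; last by rewrite numul0l; exact: lin_span0.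
  have [eq|eq] := eqVneq (prng q) (src e); last first.
    rewrite -prng_lpath_star numulA lghost_vert eq_sym (negPf eq) numul0l.
    exact: lin_span0.
  have [q' [lq <-]] := path_snoc_exists eq.
  rewrite -prng_lpath_star; apply: (@lpa_comp_gen (VertexPath _)).
  by rewrite /= lq -pqn -addn1 PoszD opprD addrA.
rewrite numulA lghost_edge; case: eqP => [->|_]; last first.
  by rewrite !numul0l; exact: lin_span0.
rewrite fp' psrc_lpath; apply: lpa_comp_gen.
by rewrite -pqn lp -addn1 PoszD addrAC addrK.
Qed.

Lemma lpa_comp_vert v : lpa_comp 0 (lvert K v).
Proof.
rewrite -lvertK.
exact: (@lpa_comp_gen (VertexPath v) (VertexPath v)).
Qed.

Lemma lpa_comp_edge e : lpa_comp 1 (ledge K e).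
Proof.
by have := lpa_comp_edge_mul e (lpa_comp_vert (rng e)); rewrite ledge_rng.
Qed.

Lemma lpa_comp_ghost e : lpa_comp (-1) (lghost K e).
Proof.
by have := lpa_comp_ghost_mul e (lpa_comp_vert (src e)); rewrite lghost_src.
Qed.

Lemma lpa_comp_lpath_mul p n x :
  lpa_comp n x -> lpa_comp (n + (plen p)%:Z) (lpath K p ** x).
Proof.
move=> nx; elim/gpath_ind_cons: p => [v|e p q [_ _ _ lq [-> _]] IH] /=.
  rewrite addr0; move: nx; apply: (lin_span_map (f := numul _)).
  move=> _ [p [q [pqn ->]]] /=; rewrite -psrc_lpath 2!numulA lvert_mul.
  case: eqP => [->|_]; last by rewrite !numul0l; exact: lin_span0.
  by rewrite psrc_lpath; exact: lpa_comp_gen.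
by rewrite -numulA lq -addn1 PoszD addrA; exact: lpa_comp_edge_mul.
Qed.

Lemma lpa_comp_lpath_star_mul p n x :
  lpa_comp n x -> lpa_comp (n - (plen p)%:Z) (lpath_star K p ** x).
Proof.
elim/gpath_ind_cons: p n x => [v|e p q [_ _ _ lq [_ ->]] IH] n x nx.
  by rewrite subr0; have := lpa_comp_lpath_mul (VertexPath v) nx; rewrite addr0.
rewrite -numulA lq -addn1 PoszD opprD [- _ + _]addrC addrA.
by apply: IH; exact: lpa_comp_ghost_mul.
Qed.

(** A monomial is a product of generators, so it suffices to know how left
    multiplication by a single generator shifts the degree. *)
Lemma lpa_comp_mul m n x y :
  lpa_comp m x -> lpa_comp n y -> lpa_comp (m + n) (x ** y).
Proof.
move=> mx ny; rewrite -[x ** y]/(numulr y x); move: mx.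
apply: (lin_span_map (f := numulr y)) => _ [p [q [<- ->]]].
rewrite /= /numulr -numulA addrC [_%:Z - _]addrC addrA.
exact/lpa_comp_lpath_mul/lpa_comp_lpath_star_mul.
Qed.

Section Star.
Variable kstar : {rmorphism K -> K}.

Lemma lpa_star0 : lpa_star kstar (0 : L) = 0.
Proof. by rewrite -{1}(scale0r (0 : L)) lpa_starZ rmorph0 scale0r. Qed.

Lemma lpa_star_vert v : lpa_star kstar (lvert K v) = lvert K v.
Proof. exact: lpa_starE. Qed.

Lemma lpa_star_edge e : lpa_star kstar (ledge K e) = lghost K e.
Proof. exact: lpa_starE. Qed.

Lemma lpa_star_ghost e : lpa_star kstar (lghost K e) = ledge K e.
Proof. exact: lpa_starE. Qed.

Lemma lpa_starN x : lpa_star kstar (- x) = - lpa_star kstar x.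
Proof. by rewrite -scaleN1r lpa_starZ rmorphN1 scaleN1r. Qed.

Lemma lpa_star_bigsum I (r : seq I) (F : I -> L) :
  lpa_star kstar (\sum_(i <- r) F i) = \sum_(i <- r) lpa_star kstar (F i).
Proof.
elim: r => [|i r IH]; first by rewrite !big_nil lpa_star0.
by rewrite !big_cons lpa_starD IH.
Qed.

Lemma lpa_starK : involutive kstar -> involutive (lpa_star kstar (E := E)).
Proof.
move=> kK x; elim/lpa_ind: x.
- by rewrite !lpa_star0.
- by move=> x y; rewrite !lpa_starD => -> ->.
- by move=> k x; rewrite !lpa_starZ kK => ->.
- by move=> x y; rewrite !lpa_starM => -> ->.
- by move=> v; rewrite !lpa_star_vert.
- by move=> e; rewrite lpa_star_edge lpa_star_ghost.
- by move=> e; rewrite lpa_star_ghost lpa_star_edge.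
Qed.

Lemma lpa_comp_star n x : lpa_comp n x -> lpa_comp (- n) (lpa_star kstar x).
Proof.
elim/lin_span_ind => {x} [|x y|k x|_ [p [q [<- ->]]]].
- by rewrite lpa_star0; exact: lin_span0.
- by rewrite lpa_starD; exact: lin_spanD.
- by rewrite lpa_starZ; exact: lin_spanZ.
- rewrite lpa_starM lpa_star_path lpa_star_ghost_path opprB.
  exact: lpa_comp_gen.
Qed.

End Star.

(** Only finitely many vertices occur in an element. *)
Lemma lpa_right_unit x :
  exists2 r, uniq r & x = \sum_(v <- r) x ** lvert K v.
Proof.
apply: (@finitely_supportedE _ _ _ (fun v => numulr (lvert K v))).
elim/lpa_ind: x => [|x y|k x|x y _ [r yr]|v|e|e].
- exact: finitely_supported0.
- exact: finitely_supportedD.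
- exact: finitely_supportedZ.
- exists r => s us rs; rewrite {1}(yr s) // numul_sumr.
  by apply: eq_bigr => v _; rewrite /= /numulr numulA.
- apply: (@finitely_supported1 _ _ _ _ v); rewrite /= /numulr ?lvertK // => w.
  by rewrite lvert_mul eq_sym => /negPf ->.
- apply: (@finitely_supported1 _ _ _ _ (rng e)); rewrite /= /numulr ?ledge_rng //.
  by move=> w; rewrite ledge_vert eq_sym => /negPf ->.
- apply: (@finitely_supported1 _ _ _ _ (src e)); rewrite /= /numulr ?lghost_src //.
  by move=> w; rewrite lghost_vert eq_sym => /negPf ->.
Qed.

End Paths.

(** * Coverings of graphs and the action they induce *)

Section RightModuleMaps.
Variables (K : fieldType) (P : digraph).
Notation A := (lpa K P).

Definition right_module_map (f : A -> A) :=
  (forall k x y, f (k *: x + y) = k *: f x + f y) /\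
  (forall x y, f (x ** y) = f x ** y).

Lemma rmmD f x y : right_module_map f -> f (x + y) = f x + f y.
Proof. by move=> [fl _]; rewrite -{1}[x]scale1r fl scale1r. Qed.

Lemma rmm0 f : right_module_map f -> f 0 = 0.
Proof.
by move=> [fl _]; apply: (addrI (f 0)); rewrite addr0 -{1}[f 0]scale1r -fl scale1r addr0.
Qed.

Lemma rmmZ f k x : right_module_map f -> f (k *: x) = k *: f x.
Proof. by move=> hf; rewrite -[k *: x]addr0 (proj1 hf) rmm0 // addr0. Qed.

Lemma rmmM f x y : right_module_map f -> f (x ** y) = f x ** y.
Proof. by case. Qed.

Lemma rmm_zero : right_module_map (0 : A -> A).
Proof. by split=> *; rewrite /= ?scaler0 ?addr0 ?numul0l. Qed.

Lemma rmm_add f g :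
  right_module_map f -> right_module_map g -> right_module_map (f + g).
Proof.
move=> [fl fM] [gl gM]; split=> [k x y|x y] /=.
  by rewrite addrfctE fl gl scalerDr addrACA.
by rewrite addrfctE fM gM numulDl.
Qed.

Lemma rmm_scale k f : right_module_map f -> right_module_map (k *: f).
Proof.
move=> hf; split=> [l x y|x y].
  by rewrite scalrfctE (proj1 hf) scalerDr !scalerA mulrC.
by rewrite scalrfctE (proj2 hf) numulZl.
Qed.

Lemma rmm_comp f g :
  right_module_map f -> right_module_map g -> right_module_map (f \o g).
Proof.
move=> [fl fM] [gl gM]; split=> [k x y|x y] /=.
  by rewrite gl fl.
by rewrite gM fM.
Qed.

Lemma rmm_mul a : right_module_map (numul a).
Proof. by split=> *; rewrite ?numulA // numulDr numulZr. Qed.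

Lemma rmm_ext f g : right_module_map f -> right_module_map g ->
  (forall w, f (lvert K w) = g (lvert K w)) -> f = g.
Proof.
move=> hf hg fg; apply/funext; elim/lpa_ind => [|x y fx fy|k x fx|x y fx _|//|e|e].
- by rewrite !rmm0.
- by rewrite !rmmD // fx fy.
- by rewrite !rmmZ // fx.
- by rewrite !rmmM // fx.
- by rewrite -lvert_src !rmmM // fg.
- by rewrite -lvert_rng !rmmM // fg.
Qed.

Lemma rmm_sum I (r : seq I) (F : I -> A -> A) :
  (forall i, right_module_map (F i)) -> right_module_map (\sum_(i <- r) F i).
Proof.
by move=> hF; apply: big_rec => [|i f _]; [exact: rmm_zero|exact: rmm_add].
Qed.

End RightModuleMaps.

Section Covering.
Variables (P E : digraph) (pv : vertex P -> vertex E) (pe : edge P -> edge E).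

(** The map from the porcupine graph to [E] (each new vertex [w^p] goes to the
    source of [p], each new edge [f^p] to the first edge of [p]) has unique
    lifting of edges with prescribed range: the edges into [w] correspond to
    the edges into its image. Edges with prescribed source lift in at most one
    way. With [cov_regular], which carries (CK2) over, this is all that is needed
    to let [lpa K E] act on [lpa K P]. *)
Record in_covering : Prop := {
  cov_src : forall h, pv (src h) = src (pe h);
  cov_rng : forall h, pv (rng h) = rng (pe h);
  cov_lift : forall e w, rng e = pv w -> exists h, pe h = e /\ rng h = w;
  cov_rng_inj : forall h h', pe h = pe h' -> rng h = rng h' -> h = h';
  cov_src_inj : forall h h', pe h = pe h' -> src h = src h' -> h = h';
  cov_regular : forall w, regular (pv w) -> ~ sink w
}.

Hypothesis cov : in_covering.
Variable K : fieldType.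
Notation A := (lpa K P).
Notation L := (lpa K E).

Lemma cov_regularP w : regular (pv w) -> regular w.
Proof.
move=> rw; split; first exact: cov_regular.
apply; case: rw => _ /contrapT fw.
have inj : {in out_edges w &, injective pe}.
  by move=> h h' /set_mem hw /set_mem h'w /(cov_src_inj cov); rewrite hw h'w; exact.
rewrite -(eq_finite_set (inj_card_eq inj)).
apply: sub_finite_set fw => _ [h <- <-]; exact/esym/cov_src.
Qed.

Definition lift_vert v w : A := if pv w == v then lvert K w else 0.

Definition lift_edge e w : A :=
  if pselect (exists h, pe h = e /\ rng h = w) is left ex
  then ledge K (sval (cid ex)) else 0.

Definition lift_ghost e w : A :=
  if pselect (exists h, pe h = e /\ src h = w) is left ex
  then lghost K (sval (cid ex)) else 0.

Lemma lift_edgeE h : lift_edge (pe h) (rng h) = ledge K h.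
Proof.
rewrite /lift_edge; case: pselect => [ex|]; last by case; exists h.
by case: cid => h' [/= e r]; rewrite (cov_rng_inj cov e r).
Qed.

Lemma lift_ghostE h : lift_ghost (pe h) (src h) = lghost K h.
Proof.
rewrite /lift_ghost; case: pselect => [ex|]; last by case; exists h.
by case: cid => h' [/= e r]; rewrite (cov_src_inj cov e r).
Qed.

Variant lift_edge_spec e w : A -> Prop :=
| LiftEdge h of e = pe h & w = rng h : lift_edge_spec e w (ledge K h)
| NoLiftEdge of rng e <> pv w : lift_edge_spec e w 0.

Lemma lift_edgeP e w : lift_edge_spec e w (lift_edge e w).
Proof.
have [/(cov_lift cov)[h [<- <-]]|ew] := pselect (rng e = pv w).
  by rewrite lift_edgeE; apply: LiftEdge.
rewrite /lift_edge; case: pselect => [[h [he hw]]|_]; last exact: NoLiftEdge.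
by case: ew; rewrite -he -hw cov_rng.
Qed.

Variant lift_ghost_spec e w : A -> Prop :=
| LiftGhost h of e = pe h & w = src h : lift_ghost_spec e w (lghost K h)
| NoLiftGhost of (forall h, pe h = e -> src h <> w) : lift_ghost_spec e w 0.

Lemma lift_ghostP e w : lift_ghost_spec e w (lift_ghost e w).
Proof.
have [[h [<- <-]]|ew] := pselect (exists h, pe h = e /\ src h = w).
  by rewrite lift_ghostE; apply: LiftGhost.
rewrite /lift_ghost; case: pselect => // _; apply: NoLiftGhost => h he hw.
by apply: ew; exists h.
Qed.

(** Formally an edge [e] acts as the left multiplication by the sum, possibly
    infinite, of the edges [h] of [P] above [e], and [e^*] by the sum of their
    ghosts. Unique lifting makes exactly one term, or none, survive on each
    vertex [w], so that these are right module maps of [lpa K P]. The relation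
    (CK1) reflects the injectivity on the edges with a given source, and (CK2)
    at a regular [v] is (CK2) of [P] at each vertex [w] above [v]. *)
Lemma cov_act_exists : exists act : L -> A -> A,
  [/\ forall k x y a, act (k *: x + y) a = k *: act x a + act y a,
      forall x y a, act (x ** y) a = act x (act y a),
      forall x, right_module_map (act x) &
      [/\ forall v w, act (lvert K v) (lvert K w) = lift_vert v w,
          forall e w, act (ledge K e) (lvert K w) = lift_edge e w &
          forall e w, act (lghost K e) (lvert K w) = lift_ghost e w]].
Proof.
have ext (t : vertex P -> A) : (forall w, t w ** lvert K w = t w) ->
    exists f, right_module_map f /\ forall w, f (lvert K w) = t w.
  by move=> /lpa_rmap_exists[f [fl fM fv]]; exists f.
have /choice[av avP] v : exists f : A -> A,
    right_module_map f /\ forall w, f (lvert K w) = lift_vert v w.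
  by apply: ext => w; rewrite /lift_vert; case: ifP; rewrite ?lvertK ?numul0l.
have /choice[ae aeP] e : exists f : A -> A,
    right_module_map f /\ forall w, f (lvert K w) = lift_edge e w.
  apply: ext => w; case: lift_edgeP => [h _ ->|_]; last by rewrite numul0l.
  by rewrite ledge_rng.
have /choice[ag agP] e : exists f : A -> A,
    right_module_map f /\ forall w, f (lvert K w) = lift_ghost e w.
  apply: ext => w; case: lift_ghostP => [h _ ->|_]; last by rewrite numul0l.
  by rewrite lghost_src.
have avM v := proj1 (avP v); have avE v := proj2 (avP v).
have aeM v := proj1 (aeP v); have aeE v := proj2 (aeP v).
have agM v := proj1 (agP v); have agE v := proj2 (agP v).
have [] := @lpa_eval_exists K E (A -> A) (fun f g => f \o g)
  (@right_module_map K P) _ _ _ _ _ (@rmm_zero K P) (@rmm_add K P)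
  (@rmm_scale K P) (@rmm_comp K P) av ae ag avM aeM agM.
- by move=> f g h.
- by move=> f g h.
- by move=> k f g.
- by move=> f g h hf; apply/funext => x; exact: rmmD.
- by move=> k f g hf; apply/funext => x; exact: rmmZ.
- move=> v v'; apply: rmm_ext; [exact: rmm_comp|by case: eqP => // _; exact: rmm_zero|].
  move=> w /=; rewrite avE /lift_vert; case: (pv w =P v') => [<-|wv'].
    by rewrite avE /lift_vert eq_sym; case: eqP => // ->; rewrite avE /lift_vert eqxx.
  rewrite rmm0 //; case: eqP => // vv'.
  by rewrite avE /lift_vert vv'; case: eqP.
- move=> e; apply: rmm_ext => // [|w /=]; first exact: rmm_comp.
  rewrite aeE; case: lift_edgeP => [h -> _|_]; last by rewrite rmm0.
  by rewrite -{1}lvert_src rmmM // avE /lift_vert cov_src // eqxx lvert_src.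
- move=> e; apply: rmm_ext => // [|w /=]; first exact: rmm_comp.
  rewrite avE /lift_vert; case: eqP => // we; rewrite rmm0 // aeE.
  by case: lift_edgeP => // h eh wh; case: we; rewrite wh cov_rng // eh.
- move=> e; apply: rmm_ext => // [|w /=]; first exact: rmm_comp.
  rewrite agE; case: lift_ghostP => [h -> _|_]; last by rewrite rmm0.
  by rewrite -{1}lvert_rng rmmM // avE /lift_vert cov_rng // eqxx lvert_rng.
- move=> e; apply: rmm_ext => // [|w /=]; first exact: rmm_comp.
  rewrite avE /lift_vert; case: eqP => // we; rewrite rmm0 // agE.
  by case: lift_ghostP => // h eh wh; case: we; rewrite wh cov_src // eh.
- move=> e f; apply: rmm_ext; [exact: rmm_comp|by case: eqP => // _; exact: rmm_zero|].
  move=> w /=; rewrite aeE; case: lift_edgeP => [h -> ->|fw].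
    rewrite -{1}lvert_src rmmM // agE; case: lift_ghostP => [h' -> hh'|noh].
      rewrite lghost_edge; have [->|h'h] := eqVneq h' h.
        by rewrite eqxx avE /lift_vert cov_rng // eqxx.
      by case: eqP => // /(cov_src_inj cov) h'h'; rewrite h'h' ?eqxx in h'h.
    rewrite numul0l; case: eqP => // eh; by case: (noh h).
  rewrite rmm0 //; case: eqP => // ef; rewrite avE /lift_vert ef.
  by case: eqP => // wf; case: fw.
- move=> v rv; apply: rmm_ext => // [|w /=].
    by apply: rmm_sum => e; exact: rmm_comp.
  have [_ /contrapT fv] := rv.
  rewrite fct_sumE avE /lift_vert; case: eqP => [wv|wv] /=; last first.
    rewrite big_seq big1 // => e; rewrite in_fset_set // inE => ev.
    rewrite agE; case: lift_ghostP => [h eh wh|_]; last by rewrite rmm0.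
    by case: wv; rewrite wh cov_src // -eh.
  have rw : regular w by apply: cov_regularP; rewrite wv.
  have [_ /contrapT fw] := rw.
  have outw h : (h \in (fset_set (out_edges w) : seq _)) = (src h == w).
    by rewrite in_fset_set //; apply/idP/eqP; rewrite inE.
  have outv e : (e \in (fset_set (out_edges v) : seq _)) = (src e == v).
    by rewrite in_fset_set //; apply/idP/eqP; rewrite inE.
  (* Both sides count the edges out of [w], grouped by their image in [E]. *)
  transitivity (\sum_(h <- fset_set (out_edges w))
     \sum_(e <- fset_set (out_edges v))
       if e == pe h then ledge K h ** lghost K h else 0).
    rewrite (lvert_CK2 _ rw) big_seq [RHS]big_seq; apply: eq_bigr => h.
    rewrite outw => /eqP hw; rewrite (bigD1_seq (pe h)) ?fset_uniq //=; last first.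
      by rewrite outv -cov_src // hw wv.
    rewrite eqxx big1 ?addr0 // => e /negPf -> //.
  rewrite exchange_big big_seq [RHS]big_seq; apply: eq_bigr => e.
  rewrite outv => /eqP ev; rewrite agE; case: lift_ghostP => [h eh wh|noh].
    subst w; rewrite (bigD1_seq h) ?fset_uniq ?outw //= eh eqxx big_seq_cond.
    rewrite big1 ?addr0 => [|h' /andP[]].
      by rewrite -{2}lvert_rng rmmM // aeE lift_edgeE.
    rewrite outw => /eqP hw h'h; case: eqP => // /(cov_src_inj cov) hh.
    by rewrite hh ?eqxx // in h'h.
  rewrite rmm0 // big_seq big1 // => h; rewrite outw => /eqP hw.
  by case: eqP => // eh; case: (noh h).
move=> act [al aM aD [a1 a2 a3]]; exists act; split=> //.
- by move=> k x y a; rewrite al.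
- by move=> x y a; rewrite aM.
- split=> [v w|e w|e w]; by rewrite (a1, a2, a3) (avE, aeE, agE).
Qed.

Definition cov_act : L -> A -> A := sval (cid cov_act_exists).

Lemma cov_act_linear k x y a :
  cov_act (k *: x + y) a = k *: cov_act x a + cov_act y a.
Proof. by rewrite /cov_act; case: cid => act []. Qed.
Lemma cov_actM x y a : cov_act (x ** y) a = cov_act x (cov_act y a).
Proof. by rewrite /cov_act; case: cid => act []. Qed.
Lemma cov_act_rmm x : right_module_map (cov_act x).
Proof. by rewrite /cov_act; case: cid => act []. Qed.
Lemma cov_act_vert v w : cov_act (lvert K v) (lvert K w) = lift_vert v w.
Proof. by rewrite /cov_act; case: cid => act [? ? ? []]. Qed.
Lemma cov_act_edge e w : cov_act (ledge K e) (lvert K w) = lift_edge e w.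
Proof. by rewrite /cov_act; case: cid => act [? ? ? []]. Qed.
Lemma cov_act_ghost e w : cov_act (lghost K e) (lvert K w) = lift_ghost e w.
Proof. by rewrite /cov_act; case: cid => act [? ? ? []]. Qed.

Lemma cov_act0 a : cov_act 0 a = 0.
Proof.
by rewrite -{1}(subrr (0 : L)) addrC -scaleN1r cov_act_linear scaleN1r addNr.
Qed.

End Covering.

(** * The isomorphism onto the ideal of a family of projections *)

Section CornerIsomorphism.
Variables (K : fieldType) (kstar : {rmorphism K -> K}).
Variables (P E : digraph) (pv : vertex P -> vertex E) (pe : edge P -> edge E).
Hypothesis cov : in_covering pv pe.
Notation A := (lpa K P).
Notation L := (lpa K E).
Variable theta : vertex P -> L.

(** The data for a morphism [lpa K P -> lpa K E] sending a vertex [w] to a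
    projection [theta w] under [pv w] and an edge [h] to [pe h ** theta (rng h)].
    The last condition says that [theta w] acts on [lpa K P] as the left
    multiplication by [w], which makes the action a left inverse of the
    morphism. *)
Record projection_lift : Prop := {
  plift_orth : forall w w',
    theta w ** theta w' = if w == w' then theta w else 0;
  plift_star : forall w, lpa_star kstar (theta w) = theta w;
  plift_deg0 : forall w, lpa_comp 0 (theta w);
  plift_vert : forall w, lvert K (pv w) ** theta w = theta w;
  plift_ghost : forall h, lghost K (pe h) ** theta (src h) =
    theta (rng h) ** lghost K (pe h);
  plift_ghost0 : forall e w, (forall h, pe h = e -> src h <> w) ->
    lghost K e ** theta w = 0;
  plift_CK2 : forall w, regular w -> theta w =
    \sum_(h <- fset_set (out_edges w))
      ledge K (pe h) ** theta (rng h) ** lghost K (pe h);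
  plift_act : forall w w', cov_act cov (theta w) (lvert K w') =
    if w == w' then lvert K w else 0
}.

Hypothesis lift : projection_lift.

Lemma plift_idem w : theta w ** theta w = theta w.
Proof. by rewrite plift_orth // eqxx. Qed.

Lemma plift_edge h :
  theta (src h) ** ledge K (pe h) = ledge K (pe h) ** theta (rng h).
Proof.
apply/esym; have := congr1 (lpa_star kstar) (plift_ghost lift h).
by rewrite !lpa_starM !plift_star // lpa_star_ghost.
Qed.

Lemma plift_vertr w : theta w ** lvert K (pv w) = theta w.
Proof.
have := congr1 (lpa_star kstar) (plift_vert lift w).
by rewrite lpa_starM lpa_star_vert plift_star.
Qed.

Lemma plift_hom_exists : exists phi : A -> L,
  [/\ forall k x y, phi (k *: x + y) = k *: phi x + phi y,
      forall x y, phi (x ** y) = phi x ** phi y &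
      [/\ forall w, phi (lvert K w) = theta w,
          forall h, phi (ledge K h) = ledge K (pe h) ** theta (rng h) &
          forall h, phi (lghost K h) = theta (rng h) ** lghost K (pe h)]].
Proof.
have [] := @lpa_eval_exists K P L (@numul K _) setT (@numulA K _)
  (@numulDl K _) (@numulZl K _) _ _ I _ _ _ theta
  (fun h => ledge K (pe h) ** theta (rng h))
  (fun h => theta (rng h) ** lghost K (pe h)) (fun=> I) (fun=> I) (fun=> I)
  (plift_orth lift); rewrite //=.
- by move=> *; exact: numulDr.
- by move=> *; exact: numulZr.
- by move=> h; rewrite -plift_edge numulA plift_idem.
- by move=> h; rewrite -numulA plift_idem.
- by move=> h; rewrite numulA plift_idem.
- by move=> h; rewrite -plift_ghost // -numulA plift_idem.
- move=> h h'; rewrite numulA -(numulA (theta _)) lghost_edge.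
  have [->|hh'] := eqVneq h h'; first by rewrite eqxx -(cov_rng cov) plift_vertr plift_idem.
  case: eqP => [ee|_]; last by rewrite numul0r numul0l.
  rewrite -(cov_rng cov) plift_vertr plift_orth //.
  by case: eqP => // /(cov_rng_inj cov ee) hh; rewrite hh eqxx in hh'.
- move=> w /(plift_CK2 lift) ->; apply: eq_bigr => h _.
  by rewrite !numulA -(numulA _ _ (theta _)) plift_idem.
by move=> phi [pl pM _ pg]; exists phi.
Qed.

Section Map.
Variable phi : A -> L.
Hypotheses (phi_lin : forall k x y, phi (k *: x + y) = k *: phi x + phi y)
  (phiM : forall x y, phi (x ** y) = phi x ** phi y)
  (phi_vert : forall w, phi (lvert K w) = theta w)
  (phi_edge : forall h, phi (ledge K h) = ledge K (pe h) ** theta (rng h))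
  (phi_ghost : forall h, phi (lghost K h) = theta (rng h) ** lghost K (pe h)).

Lemma lift_homD x y : phi (x + y) = phi x + phi y.
Proof. by rewrite -{1}[x]scale1r phi_lin scale1r. Qed.

Lemma lift_hom0 : phi 0 = 0.
Proof. by apply: (addrI (phi 0)); rewrite -lift_homD !addr0. Qed.

Lemma lift_homZ k x : phi (k *: x) = k *: phi x.
Proof. by rewrite -[k *: x]addr0 phi_lin lift_hom0 addr0. Qed.

(** The morphism intertwines the action with left multiplication. Therefore
    its range is a left ideal. *)
Lemma lift_hom_cov_act x a : phi (cov_act cov x a) = x ** phi a.
Proof.
have red z : (forall w, phi (cov_act cov z (lvert K w)) = z ** phi (lvert K w)) ->
    forall b, phi (cov_act cov z b) = z ** phi b.
  move=> zv; have zr := cov_act_rmm cov z.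
  elim/lpa_ind => [|b c zb zc|k b zb|b c zb _|//|h|h].
  - by rewrite rmm0 // lift_hom0 numul0r.
  - by rewrite rmmD // !lift_homD zb zc numulDr.
  - by rewrite rmmZ // !lift_homZ zb numulZr.
  - by rewrite rmmM // !phiM zb numulA.
  - by rewrite -lvert_src rmmM // !phiM zv numulA.
  - by rewrite -lvert_rng rmmM // !phiM zv numulA.
elim/lpa_ind: x a => [|x y IHx IHy|k x IH|x y IHx IHy|v|e|e].
- by move=> a; rewrite cov_act0 lift_hom0 numul0l.
- move=> a; rewrite -[x]scale1r cov_act_linear !scale1r lift_homD IHx IHy.
  by rewrite numulDl.
- by move=> a; rewrite -{1}[k *: x]addr0 cov_act_linear cov_act0 addr0 lift_homZ IH numulZl.
- by move=> a; rewrite cov_actM IHx IHy numulA.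
- apply: red => w; rewrite cov_act_vert /lift_vert phi_vert.
  case: eqP => [<-|wv]; first by rewrite phi_vert plift_vert.
  rewrite lift_hom0 -plift_vert // numulA lvert_mul eq_sym.
  by case: eqP => // _; rewrite numul0l.
- apply: red => w; rewrite cov_act_edge phi_vert.
  case: (lift_edgeP cov) => [h -> ->|ew]; first by rewrite phi_edge.
  rewrite lift_hom0 -plift_vert // numulA ledge_vert.
  by case: eqP => // _; rewrite numul0l.
- apply: red => w; rewrite cov_act_ghost phi_vert.
  case: (lift_ghostP cov) => [h -> ->|noh]; first by rewrite phi_ghost plift_ghost.
  by rewrite lift_hom0 plift_ghost0.
Qed.

(** The image of [b] acts as the left multiplication by [b]. Since [lpa K P]
    has local units, [b] can be recovered from its image. *)
Lemma cov_act_lift_hom b a : cov_act cov (phi b) a = b ** a.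
Proof.
elim/lpa_ind: b a => [|b c IHb IHc|k b IH|b c IHb IHc|w|h|h] a.
- by rewrite lift_hom0 cov_act0 numul0l.
- by rewrite lift_homD -[phi b]scale1r cov_act_linear scale1r IHb IHc numulDl.
- by rewrite -[k *: b]addr0 phi_lin cov_act_linear IH lift_hom0 cov_act0 !addr0 numulZl.
- by rewrite phiM cov_actM IHc IHb numulA.
- congr ((_ : A -> A) a); apply: rmm_ext; [exact: cov_act_rmm|exact: rmm_mul|].
  by move=> w'; rewrite phi_vert plift_act // lvert_mul.
- congr ((_ : A -> A) a); apply: rmm_ext; [exact: cov_act_rmm|exact: rmm_mul|].
  move=> w'; rewrite phi_edge cov_actM plift_act // ledge_vert.
  case: eqP => _; first by rewrite cov_act_edge (lift_edgeE cov).
  by rewrite rmm0 //; exact: cov_act_rmm.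
- congr ((_ : A -> A) a); apply: rmm_ext; [exact: cov_act_rmm|exact: rmm_mul|].
  move=> w'; rewrite phi_ghost cov_actM cov_act_ghost lghost_vert.
  case: (lift_ghostP cov) => [h' hh' ->|noh].
    rewrite -{1}lvert_rng rmmM ?plift_act //; last exact: cov_act_rmm.
    case: eqP => [/(cov_rng_inj cov hh') <-|rr].
      by rewrite eqxx lvert_rng.
    case: eqP => [/(cov_src_inj cov hh') hh|_]; last by rewrite numul0l.
    by case: rr; rewrite hh.
  rewrite rmm0; last exact: cov_act_rmm.
  by case: eqP => // /noh; case.
Qed.

Lemma lift_hom_inj : injective phi.
Proof.
move=> x y xy; apply/eqP; rewrite -subr_eq0; apply/eqP.
have [r _ ->] := lpa_right_unit (x - y); apply: big1 => w _.
rewrite -cov_act_lift_hom lift_homD -scaleN1r lift_homZ xy scaleN1r subrr.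
exact: cov_act0.
Qed.

Lemma lift_hom_star x : phi (lpa_star kstar x) = lpa_star kstar (phi x).
Proof.
elim/lpa_ind: x => [|x y IHx IHy|k x IH|x y IHx IHy|w|h|h].
- by rewrite lift_hom0 !lpa_star0 lift_hom0.
- by rewrite lift_homD !lpa_starD lift_homD IHx IHy.
- by rewrite lift_homZ !lpa_starZ lift_homZ IH.
- by rewrite phiM !lpa_starM phiM IHx IHy.
- by rewrite lpa_star_vert phi_vert plift_star.
- by rewrite lpa_star_edge phi_ghost phi_edge lpa_starM plift_star // lpa_star_edge.
- by rewrite lpa_star_ghost phi_ghost phi_edge lpa_starM plift_star // lpa_star_ghost.
Qed.

Lemma lift_hom_lpath p : lpa_comp (plen p)%:Z (phi (lpath K p)).
Proof.
elim/(@gpath_ind_cons K): p => [w|h p q [_ _ _ -> [-> _]] IH].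
  by rewrite phi_vert; exact: plift_deg0.
rewrite phiM phi_edge -addn1 PoszD addrC; apply: lpa_comp_mul; last exact: IH.
rewrite -[X in lpa_comp X]addr0; apply: lpa_comp_mul; first exact: lpa_comp_edge.
exact: plift_deg0.
Qed.

Lemma lift_hom_comp n x : lpa_comp n x -> lpa_comp n (phi x).
Proof.
elim/lin_span_ind => {x} [|x y|k x|_ [p [q [<- ->]]]].
- by rewrite lift_hom0; exact: lin_span0.
- by rewrite lift_homD; exact: lin_spanD.
- by rewrite lift_homZ; exact: lin_spanZ.
- rewrite phiM -(lpa_star_path kstar) lift_hom_star.
  apply: lpa_comp_mul; first exact: lift_hom_lpath.
  exact/lpa_comp_star/lift_hom_lpath.
Qed.

(** The range is a left ideal, and a right one because it is stable under the
    involution. *)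
Lemma lift_hom_range : involutive kstar -> range phi = ideal_gen (range theta).
Proof.
move=> kK; apply/seteqP; split.
  have hI := ideal_gen_ideal (range theta).
  have It w : ideal_gen (range theta) (theta w).
    by apply: sub_gen_smallest; exists w.
  move=> _ [x _ <-]; elim/lpa_ind: x => [|x y IHx IHy|k x IH|x y IHx IHy|w|h|h].
  - by rewrite lift_hom0; exact: (Defs.ideal0 hI).
  - by rewrite lift_homD; exact: (Defs.idealD hI).
  - by rewrite lift_homZ; exact: (Defs.idealZ hI).
  - by rewrite phiM; exact: (Defs.idealMl hI).
  - by rewrite phi_vert.
  - by rewrite phi_edge; exact: (Defs.idealMl hI).
  - by rewrite phi_ghost; exact: (Defs.idealMr hI).
apply: smallest_sub => [|_ [w _ <-]]; last by exists (lvert K w); rewrite ?phi_vert.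
have phiL a x : range phi (a ** phi x) by exists (cov_act cov a x); rewrite ?lift_hom_cov_act.
split=> [|_ _ [x _ <-] [y _ <-]|k _ [x _ <-]|a _ [x _ <-]|a _ [x _ <-]].
- by exists 0; rewrite ?lift_hom0.
- by exists (x + y); rewrite ?lift_homD.
- by exists (k *: x); rewrite ?lift_homZ.
- exact: phiL.
- have [y _ yE] := phiL (lpa_star kstar a) (lpa_star kstar x).
  exists (lpa_star kstar y) => //.
  by rewrite lift_hom_star yE lift_hom_star lpa_starM !lpa_starK.
Qed.

End Map.

Lemma plift_iso : involutive kstar ->
  graded_star_isomorphic kstar P (ideal_gen (range theta)).
Proof.
move=> kK; have [f [fl fM [fv fe fg]]] := plift_hom_exists.
pose phi : {linear A -> L} := HB.pack f (GRing.isLinear.Build K A L *:%R f fl).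
have fR := lift_hom_range fl fM fv fe fg kK.
exists phi; split=> //.
- exact: (lift_hom_inj fl fM fv fe fg).
- move=> n _ [x nx <-]; split; last exact: (lift_hom_comp fl fM fv fe fg).
  by rewrite -fR; exists x.
- exact: (lift_hom_star fl fM fv fe fg).
Qed.

End CornerIsomorphism.

(** * The projections [v^H] *)

Section BreakingVertex.
Variables (K : fieldType) (E : digraph) (H : set (vertex E)) (v : vertex E).
Notation L := (lpa K E).
Let B := out_edges v `&` in_edges_of (~` H).
Hypothesis finB : finite_set B.

Lemma vHE : vH K H v =
  lvert K v - \sum_(e <- fset_set B) ledge K e ** lghost K e.
Proof. by rewrite /vH fsbig_finite. Qed.

Let inB e : (e \in (fset_set B : seq _)) = (src e == v) && ~~ `[< H (rng e) >].
Proof.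
rewrite in_fset_set //; apply/idP/andP => [/set_mem[/= -> He]|[/eqP ev He]].
  by split=> //; apply/asboolPn.
by apply/mem_set; split=> //; apply/asboolPn.
Qed.

Lemma lghost_vH e : lghost K e ** vH K H v =
  if (src e == v) && `[< H (rng e) >] then lghost K e else 0.
Proof.
rewrite vHE numulBr lghost_vert numul_sumr.
have [eB|eB] := boolP (e \in (fset_set B : seq _)).
  rewrite (bigD1_seq e) ?fset_uniq //= numulA lghost_edge eqxx lvert_rng.
  rewrite big1 ?addr0 => [|f fe]; last first.
    by rewrite numulA lghost_edge eq_sym (negPf fe) numul0l.
  by move: eB; rewrite inB => /andP[-> /negPf ->]; rewrite subrr.
rewrite big_seq big1 ?subr0 => [|f fB].
  by move: eB; rewrite inB negb_and negbK; case: eqP => //= _ ->.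
rewrite numulA lghost_edge; case: eqP => [ef|]; last by rewrite numul0l.
by rewrite ef fB in eB.
Qed.

Lemma lvert_vH : lvert K v ** vH K H v = vH K H v.
Proof.
rewrite vHE numulBr lvertK numul_sumr; congr (_ - _).
rewrite big_seq [RHS]big_seq; apply: eq_bigr => e.
by rewrite inB => /andP[/eqP <- _]; rewrite numulA lvert_src.
Qed.

Lemma vH_star kstar : lpa_star kstar (vH K H v) = vH K H v.
Proof.
rewrite vHE lpa_starD lpa_starN lpa_star_vert lpa_star_bigsum.
congr (_ - _); apply: eq_bigr => e _.
by rewrite lpa_starM lpa_star_edge lpa_star_ghost.
Qed.

Lemma vH_vert : vH K H v ** lvert K v = vH K H v.
Proof.
have := congr1 (lpa_star idfun) lvert_vH.
by rewrite lpa_starM lpa_star_vert vH_star.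
Qed.

Lemma vH_edge e : vH K H v ** ledge K e =
  if (src e == v) && `[< H (rng e) >] then ledge K e else 0.
Proof.
have := congr1 (lpa_star idfun) (lghost_vH e).
rewrite lpa_starM lpa_star_ghost vH_star => ->.
by case: ifP => _; rewrite ?lpa_star_ghost ?lpa_star0.
Qed.

Lemma vHK : vH K H v ** vH K H v = vH K H v.
Proof.
rewrite {2}vHE numulBr vH_vert numul_sumr big_seq big1 ?subr0 // => e.
by rewrite inB numulA vH_edge => /andP[-> /negPf ->]; rewrite numul0l.
Qed.

Lemma vH_comp : lpa_comp 0 (vH K H v).
Proof.
rewrite vHE; apply: lin_spanD; first exact: lpa_comp_vert.
apply: lin_spanN; apply: lin_span_sum => e.
exact: (lpa_comp_mul (lpa_comp_edge K e) (lpa_comp_ghost K e)).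
Qed.

End BreakingVertex.

(** * The porcupine graph *)

Section Porcupine.
Variables (K : fieldType) (kstar : {rmorphism K -> K}) (E : digraph).
Variables (H S : set (vertex E)) (adm : admissible_pair H S).
Notation L := (lpa K E).
Notation P := (porcupine adm).

Definition porc_pv (w : vertex P) : vertex E :=
  match w with inl u => val u | inr p => src (first_edge (val p)) end.

Definition porc_pe (h : edge P) : edge E :=
  match h with inl e => val e | inr p => first_edge (val p) end.

Lemma hereditary_rng e : H (src e) -> H (rng e).
Proof.
have hH := adm_hereditary adm.
by move=> He; apply: (hH (EdgePath (exist _ (e, [::]) isT)) He).
Qed.

Lemma hereditary_last e s : path (fun e f => rng e == src f) e s ->
  H (src e) -> H (src (last e s)).
Proof.
elim: s e => //= f s IH e /andP[/eqP ef fs] He; apply: IH => //.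
by rewrite -ef; exact: hereditary_rng.
Qed.

Lemma breaking_notin u : S u -> ~ H u.
Proof. by move=> /(adm_breaking adm)[]. Qed.

Lemma porc_src_notin p : porc_F H S p -> ~ H (src (first_edge p)).
Proof.
case: p => [[e s] ps] pF He; have Hl := hereditary_last ps He.
case: pF => [[_]|Sl]; first by apply; left.
by apply: (breaking_notin Sl); apply: hereditary_rng.
Qed.

(** If the first edge of [p] ended in [H], then [p] would be that edge alone,
    because later vertices of [p] but the last are outside [H]; but an edge
    from [S] to [H] is an old edge of the porcupine. *)
Lemma porc_rng_notin p : porc_F H S p -> S (src (first_edge p)) ->
  ~ H (rng (first_edge p)).
Proof.
case: p => [[e [|f s]] ps] pF Se.
  case: pF => [[_]|]; first by case; right.
  exact: breaking_notin.
have := porc_src_notin (porc_new_rng2 pF).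
by case/andP: (ps) => /= /eqP ->.
Qed.

Lemma porc_old_new e p : porc_old_edges H S e -> porc_F H S p ->
  first_edge p = e -> False.
Proof.
move=> oe pF pe_; have := porc_src_notin pF; have := porc_rng_notin pF.
by rewrite pe_; case: oe => [He _|[Se He] /(_ Se)]; [apply|].
Qed.

(** Following the unique edge [f^p] out of [w^p] shortens [p], until an old
    vertex is reached. *)
Lemma porc_vertex_ind (C : vertex P -> Prop) :
  (forall u, C (inl u)) ->
  (forall p, C (rng (inr p : edge P)) -> C (inr p)) -> forall w, C w.
Proof.
move=> Cl Cr [u|[[[e s] ps] hp]]; first exact: Cl.
by elim: s e ps hp => [|f s IH] e ps hp; apply: Cr => /=; [exact: Cl|exact: IH].
Qed.

Lemma porc_old_eq (u u' : set_type (H `|` S)) :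
  val u = val u' -> inl u = inl u' :> vertex P.
Proof. by move=> /val_inj ->. Qed.

Definition old_edge e (he : porc_old_edges H S e) : edge P :=
  inl (exist (fun e => e \in porc_old_edges H S) e (mem_set he)).

Definition new_edge p (hp : porc_F H S p) : edge P :=
  inr (exist (fun p => p \in porc_F H S) p (mem_set hp)).

(** Unique lifting for a pair of an edge [e] and a vertex [w] above [rng e]:
    if [w = w^q], the lift is [f^{eq}]; if [w] is an old vertex, the lift is [e]
    itself or [f^e], and the definitions of [F_1] and [F_2] are such that
    exactly one of these is an edge of the porcupine. *)
Lemma porc_covering : in_covering porc_pv porc_pe.
Proof.
split.
- by case=> [[e he]|p].
- case=> [[e he]|[[[e [|f s]] ps] hp]] //=.
  by case/andP: (ps) => /= /eqP.
- move=> e [u eu|[[[f s] ps] hp] ef].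
    have [oe|noe] := pselect (porc_old_edges H S e).
      exists (old_edge oe); split=> //.
      exact: porc_old_eq.
    have pF : porc_F H S (exist _ (e, [::]) isT).
      have [Hu|Su] : (H `|` S) (rng e) by rewrite eu; apply/set_mem/(valP u).
        left; split=> // -[He|Se]; apply: noe; first by left.
        by right.
      by right.
    exists (new_edge pF); split=> //.
    exact: porc_old_eq.
  have pe_ : path (fun e f => rng e == src f) e (f :: s).
    by apply/andP; split; [apply/eqP|].
  have pF : porc_F H S (exist _ (e, f :: s) pe_) by exact: (set_mem hp).
  exists (new_edge pF); split=> //=.
  by congr inr; apply: val_inj; apply: val_inj.
- have hn e he p : porc_pe (inl (exist _ e he)) = porc_pe (inr p) -> False.
    move=> /= ep; apply: (@porc_old_new e (val p)) => //.
      exact: (set_mem he).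
    by apply: set_mem; exact: (valP p).
  case=> [[e he]|p] [[e' he']|p'].
  + by move=> /= ee _; congr inl; apply: val_inj.
  + by move/hn.
  + by move/esym/hn.
  + case: p p' => [[[e s] ps] hp] [[[e' s'] ps'] hp'] /= ee'.
    rewrite /first_edge /= in ee'; subst e'.
    case: s ps hp => [|f s] ps hp; case: s' ps' hp' => [|f' s'] ps' hp' //= rr.
      by congr inr; apply: val_inj; apply: val_inj.
    have fs : (f, s) = (f', s').
      pose g (w : vertex P) := if w is inr p then val (val p) else (f, s).
      exact: (congr1 g rr).
    by congr inr; apply: val_inj; apply: val_inj => /=; case: fs => -> ->.
- case=> [[e he]|p] [[e' he']|p'] //=; last by move=> _ [->].
  by move=> ee _; congr inl; apply: val_inj.
- case=> [u|p] [ns fin] sk; last first.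
    by have : out_edges (inr p : vertex P) (inr p : edge P) by []; rewrite sk.
  have [Hu|Su] : (H `|` S) (val u) by apply/set_mem/(valP u).
    apply: ns; apply/seteqP; split=> // e /= eu.
    have oe : porc_old_edges H S e by left; rewrite /= eu.
    have : out_edges (inl u : vertex P) (old_edge oe).
      exact: porc_old_eq.
    by rewrite sk.
  by have [_ inf _ _] := adm_breaking adm Su; exact: fin.
Qed.

Definition old_proj u : L := if `[< H u >] then lvert K u else vH K H u.

(** For [p] in [F_1], resp. [F_2], this is [p p^*], resp.
    [p r(p)^H p^*]. The recursion makes (CK2) at [w^p] and the induction along
    [f^p] immediate. *)
Fixpoint path_proj e (s : seq (edge E)) : L :=
  let x := if s is f :: s' then path_proj f s' else old_proj (rng e) in
  ledge K e ** x ** lghost K e.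

Definition porc_proj (w : vertex P) : L :=
  match w with
  | inl u => old_proj (val u)
  | inr p => path_proj (val (val p)).1 (val (val p)).2
  end.

Lemma porc_proj_old_H (u : set_type (H `|` S)) :
  H (val u) -> porc_proj (inl u) = lvert K (val u).
Proof. by move=> /asboolT Hu; rewrite /= /old_proj Hu. Qed.

Lemma porc_proj_old_S (u : set_type (H `|` S)) :
  S (val u) -> porc_proj (inl u) = vH K H (val u).
Proof. by move=> /breaking_notin /asboolF Hu; rewrite /= /old_proj Hu. Qed.

Lemma porc_proj_new p :
  porc_proj (inr p) = ledge K (porc_pe (inr p)) ** porc_proj (rng (inr p : edge P)) **
    lghost K (porc_pe (inr p)).
Proof. by case: p => [[[e [|f s]] ps] hp]. Qed.

Lemma porc_vertexP (u : set_type (H `|` S)) : H (val u) \/ S (val u).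
Proof. exact/set_mem/(valP u). Qed.

Lemma porc_newP (p : set_type (porc_F H S)) : porc_F H S (val p).
Proof. exact/set_mem/(valP p). Qed.

Lemma breaking_finite u : S u ->
  finite_set (out_edges u `&` in_edges_of (~` H)).
Proof. by move=> /(adm_breaking adm)[]. Qed.

Lemma porc_proj_vert w : lvert K (porc_pv w) ** porc_proj w = porc_proj w.
Proof.
case: w => [u|p]; last by rewrite porc_proj_new !numulA lvert_src.
have [Hu|Su] := porc_vertexP u; first by rewrite porc_proj_old_H // lvertK.
by rewrite porc_proj_old_S // lvert_vH //; exact: breaking_finite.
Qed.

Lemma porc_proj_star w : lpa_star kstar (porc_proj w) = porc_proj w.
Proof.
elim/porc_vertex_ind: w => [u|p IH]; last first.
  by rewrite porc_proj_new !lpa_starM lpa_star_edge lpa_star_ghost IH numulA.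
have [Hu|Su] := porc_vertexP u; first by rewrite porc_proj_old_H // lpa_star_vert.
by rewrite porc_proj_old_S // vH_star //; exact: breaking_finite.
Qed.

Lemma porc_proj_comp w : lpa_comp 0 (porc_proj w).
Proof.
elim/porc_vertex_ind: w => [u|p IH]; last first.
  rewrite porc_proj_new; apply: (lpa_comp_mul (m := 1) (n := -1)).
    by apply: (lpa_comp_mul (m := 1) (n := 0)) => //; exact: lpa_comp_edge.
  exact: lpa_comp_ghost.
have [Hu|Su] := porc_vertexP u; first by rewrite porc_proj_old_H //; exact: lpa_comp_vert.
by rewrite porc_proj_old_S //; apply: vH_comp; exact: breaking_finite.
Qed.

Lemma porc_proj_ghost h : lghost K (porc_pe h) ** porc_proj (src h) =
  porc_proj (rng h) ** lghost K (porc_pe h).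
Proof.
case: h => [[e he]|p]; last first.
  rewrite [src _]/= porc_proj_new !numulA lghost_edge eqxx.
  by rewrite -(cov_rng porc_covering) porc_proj_vert.
have oe := set_mem he; have He : H (rng e).
  by case: oe => [|[]] //; exact: hereditary_rng.
rewrite /= /old_proj (asboolT He) lvert_rng.
case: oe => [Hs|[Ss _]]; first by rewrite asboolT // lghost_src.
rewrite (asboolF (breaking_notin Ss)) lghost_vH; last exact: breaking_finite.
by rewrite eqxx asboolT.
Qed.

Lemma porc_proj_ghost0 e w : (forall h, porc_pe h = e -> src h <> w) ->
  lghost K e ** porc_proj w = 0.
Proof.
case: w => [u|p] noh; last first.
  rewrite porc_proj_new !numulA lghost_edge.
  by case: eqP => [ep|_]; [case: (noh (inr p))|rewrite !numul0l].
have old (oe : porc_old_edges H S e) : src e <> val u.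
  move=> eu; apply: (noh (old_edge oe)) => //; exact: porc_old_eq.
have [Hu|Su] := porc_vertexP u.
  rewrite porc_proj_old_H // lghost_vert; case: eqP => // eu.
  by case: (old _ eu); left; rewrite /= eu.
rewrite porc_proj_old_S // lghost_vH; last exact: breaking_finite.
case: eqP => //= eu; case: asboolP => // He.
by case: (old _ eu); right; rewrite /= eu.
Qed.

(** For a new vertex [w^p] and any other vertex, moving the first edge of [p]
    across reduces the claim to the range of [f^p] and a shorter path. For old
    vertices it holds since their images in [E] differ, and an old vertex is
    orthogonal to the new ones because no old edge has the same image as a new
    one. *)
Lemma porc_proj_orth w w' : porc_proj w ** porc_proj w' = if w == w' then porc_proj w else 0.
Proof.
have orth_new p w1 : (forall w2, porc_proj (rng (inr p : edge P)) ** porc_proj w2 =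
      if rng (inr p : edge P) == w2 then porc_proj (rng (inr p : edge P)) else 0) ->
    porc_proj (inr p) ** porc_proj w1 = if inr p == w1 :> vertex P then porc_proj (inr p) else 0.
  move=> IH; rewrite porc_proj_new -numulA.
  have [[h [hp <-]]|noh] :=
      pselect (exists h, porc_pe h = porc_pe (inr p) /\ src h = w1).
    rewrite -hp porc_proj_ghost numulA -(numulA (ledge K _)) IH.
    case: eqP => [rr|rr].
      rewrite -(cov_rng_inj porc_covering (esym hp) rr).
      by rewrite eqxx.
    rewrite numul0r numul0l; case: eqP => // sp; case: rr.
    by rewrite (cov_src_inj porc_covering (esym hp) sp).
  rewrite porc_proj_ghost0 ?numul0r => [|h hp hw]; last by apply: noh; exists h.
  by case: eqP => // pw; case: noh; exists (inr p).
elim/porc_vertex_ind: w w' => [u|p IH] w'; last exact: orth_new.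
have [uw|uw] := eqVneq (inl u : vertex P) w'.
  rewrite -uw; have [Hu|Su] := porc_vertexP u; first by rewrite porc_proj_old_H ?lvertK.
  by rewrite porc_proj_old_S // vHK //; exact: breaking_finite.
case: w' uw => [u'|p] uw.
  rewrite -[porc_proj (inl u')]porc_proj_vert.
  have /(congr1 (lpa_star kstar)) := porc_proj_vert (inl u).
  rewrite lpa_starM lpa_star_vert porc_proj_star => <-.
  rewrite -numulA [lvert K _ ** (_ ** _)]numulA lvert_mul.
  case: eqP => [uu|_]; last by rewrite numul0l numul0r.
  by rewrite (porc_old_eq uu) eqxx in uw.
rewrite porc_proj_new !numulA.
have -> : porc_proj (inl u) ** ledge K (porc_pe (inr p)) = 0.
  rewrite -porc_proj_star -(lpa_star_ghost kstar) -lpa_starM porc_proj_ghost0 ?lpa_star0 //.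
  case=> [[e he]|p'] //= ep _.
  exact: (porc_old_new (set_mem he) (porc_newP p) (esym ep)).
by rewrite !numul0l.
Qed.

Lemma out_edges_new p : out_edges (inr p : vertex P) = [set inr p : edge P].
Proof.
apply/seteqP; split=> h /= => [|->] //.
by case: h => [[e he]|p'] //= [->].
Qed.

Lemma lvert_new p : lvert K (inr p : vertex P) =
  ledge K (inr p : edge P) ** lghost K (inr p : edge P).
Proof.
rewrite lvert_CK2; last first.
  split; first by apply/eqP/set0P; exists (inr p).
  by apply; rewrite out_edges_new; exact: finite_set1.
by rewrite out_edges_new fset_set1 big_seq_fset1.
Qed.

(** A vertex of [S] emits infinitely many edges into [H], so it is not regular
    in the porcupine and imposes no condition. *)
Lemma porc_proj_CK2 w : regular w -> porc_proj w =
  \sum_(h <- fset_set (out_edges w))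
    ledge K (porc_pe h) ** porc_proj (rng h) ** lghost K (porc_pe h).
Proof.
case: w => [u|p] [ns /contrapT fin]; last first.
  by rewrite out_edges_new fset_set1 big_seq_fset1 porc_proj_new.
have [Hu|Su] := porc_vertexP u; last first.
  have [_ inf _ finB] := adm_breaking adm Su.
  case: (infinite_setD inf finB).
  apply: sub_finite_set (finite_image porc_pe fin) => e [/= eu eB].
  have He : H (rng e) by apply: contrapT => nH; apply: eB.
  have oe : porc_old_edges H S e by right; rewrite /= eu.
  by exists (old_edge oe) => //; exact: porc_old_eq.
have img : porc_pe @` out_edges (inl u : vertex P) = out_edges (val u).
  apply/seteqP; split=> [_ [h hu <-]|e /= eu].
    by have := cov_src porc_covering h; rewrite hu => /esym.
  have oe : porc_old_edges H S e by left; rewrite /= eu.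
  by exists (old_edge oe) => //; exact: porc_old_eq.
have fu : finite_set (out_edges (val u)) by rewrite -img; exact: finite_image.
have ru : regular (val u).
  split; last by apply.
  by move=> su; apply: ns; move: img; rewrite su => /image_set0_set0.
rewrite porc_proj_old_H // (lvert_CK2 _ ru) -!fsbig_finite // -img fsbig_image.
  apply: eq_fsbigr => h /set_mem hu; congr (_ ** _).
  case: h hu => [[e he]|//] /= eu.
  have Hr : H (rng e).
    by apply: hereditary_rng; rewrite (congr1 porc_pv eu : src e = val u).
  by rewrite /old_proj asboolT // ledge_rng.
move=> h h' /set_mem hu /set_mem hu' hh.
by apply: (cov_src_inj porc_covering hh); rewrite hu hu'.
Qed.

(** For [u] in [S] this is where [u^H] matters: [u] acts as the identity on all
    the vertices above [u], namely [u] and the [w^p] with [p] starting at [u],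
    and the sum of the [e e^*] subtracted in [u^H] is the identity on these
    [w^p] and zero on [u]. *)
Lemma porc_proj_act w w' : cov_act porc_covering (porc_proj w) (lvert K w') =
  if w == w' then lvert K w else 0.
Proof.
have rmm x := @cov_act_rmm _ _ _ _ porc_covering K x.
elim/porc_vertex_ind: w w' => [u|p IH] w'; last first.
  rewrite porc_proj_new !cov_actM cov_act_ghost.
  case: (lift_ghostP porc_covering) => [h hp ->|noh]; last first.
    rewrite !rmm0 //; case: eqP => // pw; by case: (noh (inr p)).
  rewrite -lvert_rng rmmM // IH; case: eqP => [rr|rr].
    rewrite rr -(cov_rng_inj porc_covering hp rr) lvert_rng eqxx lvert_new.
    by rewrite -{1}lvert_rng rmmM // cov_act_edge (lift_edgeE porc_covering).
  rewrite numul0l rmm0 //; case: eqP => // sp; case: rr.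
  by rewrite (cov_src_inj porc_covering hp sp).
have [Hu|Su] := porc_vertexP u.
  rewrite porc_proj_old_H // cov_act_vert /lift_vert.
  case: w' => [u'|p].
    case: eqP => [uu|uu]; first by rewrite (porc_old_eq uu) eqxx.
    by case: eqP => // -[uu']; case: uu; rewrite /= uu'.
  have /eqP/negPf -> : inl u <> inr p :> vertex P by [].
  case: eqP => // /= pu; case: (porc_src_notin (porc_newP p)); by rewrite pu.
rewrite porc_proj_old_S // vHE; last exact: breaking_finite.
set r : seq _ := fset_set _.
have inr_ e : e \in r -> src e = val u /\ ~ H (rng e).
  by rewrite in_fset_set; [move=> /set_mem|exact: breaking_finite].
have act_sum (s : seq (edge E)) (F : edge E -> L) a :
    cov_act porc_covering (\sum_(e <- s) F e) a =
    \sum_(e <- s) cov_act porc_covering (F e) a.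
  elim: s => [|e s IHs]; rewrite ?(big_nil, big_cons) ?cov_act0 //.
  by rewrite -[F e]scale1r cov_act_linear !scale1r IHs.
rewrite addrC -scaleN1r cov_act_linear scaleN1r act_sum cov_act_vert /lift_vert.
have act0 e : (forall h, porc_pe h = e -> src h <> w') ->
    cov_act porc_covering (ledge K e ** lghost K e) (lvert K w') = 0.
  move=> noh; rewrite cov_actM cov_act_ghost.
  by case: (lift_ghostP porc_covering) => [h /esym/noh + /esym|_] //; rewrite rmm0.
case: w' act0 => [u'|p] act0.
  rewrite big_seq big1 ?oppr0 ?add0r => [|e /inr_[eu nHe]].
    case: eqP => [uu|uu]; first by rewrite (porc_old_eq uu) eqxx.
    by case: eqP => // -[uu']; case: uu; rewrite /= uu'.
  apply: act0 => -[[e' he]|//] /= ee _; subst e'.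
  by case: (set_mem he) => [/hereditary_rng|[]].
have /eqP/negPf -> : inl u <> inr p :> vertex P by [].
case: eqP => /= [pu|pu]; last first.
  rewrite addr0 big_seq big1 ?oppr0 // => e /inr_[eu _]; apply: act0 => h he hp.
  by apply: pu; have := cov_src porc_covering h; rewrite hp he eu.
have pr : first_edge (val p) \in r.
  rewrite in_fset_set; last exact: breaking_finite.
  by apply/mem_set; split=> //=; apply: porc_rng_notin; rewrite ?pu //; exact: porc_newP.
rewrite (bigD1_seq _ pr) ?fset_uniq //= big1 ?addr0 => [|e ep].
  rewrite cov_actM cov_act_ghost.
  rewrite -[first_edge _]/(porc_pe (inr p)) (lift_ghostE porc_covering K (inr p)).
  rewrite -lvert_rng rmmM // cov_act_edge (lift_edgeE porc_covering).
  by rewrite -lvert_new addNr.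
apply: act0 => h he hp; move/eqP: ep; apply; rewrite -he.
by case: h hp {he} => [[e' he']//|p' [->]].
Qed.

Lemma porc_projection_lift : projection_lift kstar porc_covering porc_proj.
Proof.
split; [exact: porc_proj_orth|exact: porc_proj_star|exact: porc_proj_comp|
  exact: porc_proj_vert|exact: porc_proj_ghost|exact: porc_proj_ghost0|exact: porc_proj_CK2|
  exact: porc_proj_act].
Qed.

Lemma porc_proj_ideal : ideal_gen (range porc_proj) = ideal_HS H S.
Proof.
have hI := ideal_gen_ideal (@lvert K E @` H `|` @vH K E H @` S).
apply/seteqP; split.
  apply: smallest_sub => // _ [w _ <-].
  elim/porc_vertex_ind: w => [u|p IH].
    have [Hu|Su] := porc_vertexP u.
      by rewrite porc_proj_old_H //; apply: sub_gen_smallest; left; exists (val u).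
    by rewrite porc_proj_old_S //; apply: sub_gen_smallest; right; exists (val u).
  by rewrite porc_proj_new; apply: (Defs.idealMr hI); exact: (Defs.idealMl hI).
have old u : (H `|` S) u -> ideal_gen (range porc_proj) (old_proj u).
  move=> hu; apply: sub_gen_smallest.
  by exists (inl (exist (fun u => u \in H `|` S) u (mem_set hu)) : vertex P).
apply: smallest_sub => [|_ [[u Hu <-]|[u Su <-]]]; first exact: ideal_gen_ideal.
  by have := old u (or_introl Hu); rewrite /old_proj asboolT.
have := old u (or_intror Su); rewrite /old_proj asboolF //.
exact: breaking_notin.
Qed.

Theorem porcupine_iso : involutive kstar ->
  graded_star_isomorphic kstar P (@ideal_HS K E H S).
Proof. by move=> kK; rewrite -porc_proj_ideal; exact: plift_iso porc_projection_lift kK. Qed.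

End Porcupine.

(** * Graded ideals are generated by vertices and projections [v^H] *)

Section GradedIdeals.
Variables (K : fieldType) (kstar : {rmorphism K -> K}) (E : digraph).
Notation L := (lpa K E).
Implicit Types (x y z : L) (I J : set L).

Definition ideal_vertices I : set (vertex E) := [set v | I (lvert K v)].

Definition ideal_breaking I : set (vertex E) :=
  [set v | breaking (ideal_vertices I) v /\ I (vH K (ideal_vertices I) v)].

Lemma ideal_edge I e : two_sided_ideal I -> I (lvert K (rng e)) ->
  I (ledge K e).
Proof. by move=> hI Ie; rewrite -ledge_rng; exact: (Defs.idealMl hI). Qed.

Lemma ideal_scale I k x : two_sided_ideal I -> k != 0 -> I (k *: x) -> I x.
Proof.
move=> hI k0 /(Defs.idealZ hI k^-1).
by rewrite scalerA mulVf // scale1r.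
Qed.

Lemma ideal_hereditary I : two_sided_ideal I -> hereditary (ideal_vertices I).
Proof.
move=> hI p; elim/(@gpath_ind_cons K): p => // e p q [ep -> -> _ _] IH Ie.
apply: IH; rewrite -ep /ideal_vertices /=.
have -> : lvert K (rng e) = lghost K e ** lvert K (src e) ** ledge K e.
  by rewrite lghost_src lghost_edge eqxx.
apply: (Defs.idealMr hI); exact: (Defs.idealMl hI).
Qed.

Lemma ideal_saturated I : two_sided_ideal I -> saturated (ideal_vertices I).
Proof.
move=> hI v rv vI; rewrite /ideal_vertices /= (lvert_CK2 _ rv) big_seq.
apply: big_ind => [|x y|e ev]; [exact: ideal0|exact: (Defs.idealD hI)|].
apply: (Defs.idealMr hI); apply: ideal_edge => //; apply: vI; exists e => //.
by move: ev; rewrite in_fset_set ?inE //; case: rv => _ /contrapT.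
Qed.

Lemma ideal_admissible I : two_sided_ideal I ->
  admissible_pair (ideal_vertices I) (ideal_breaking I).
Proof.
move=> hI; split; [exact: ideal_hereditary|exact: ideal_saturated|].
by move=> v [].
Qed.

Definition sandwiches (C : set L) : set L :=
  [set x | exists e f m, C m /\ x = ledge K e ** m ** lghost K f].

(** Spanned by the [p q^*] with [|p| = |q| <= N], but defined by adding one
    edge at each end, which is the form in which inductions use it. *)
Fixpoint core (N : nat) : set L :=
  if N is N'.+1 then
    lin_span (range (@lvert K E) `|` sandwiches (core N'))
  else lin_span (range (@lvert K E)).

Definition edge_core N : set L := lin_span (sandwiches (core N)).

Lemma core_vertex N v : core N (lvert K v).
Proof.
by case: N => [|N]; apply: lin_span_gen; first exists v => //; left; exists v.
Qed.

Lemma core0 N : core N 0. Proof. by case: N => [|N]; exact: lin_span0. Qed.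

Lemma coreD N x y : core N x -> core N y -> core N (x + y).
Proof. by case: N => [|N]; exact: lin_spanD. Qed.

Lemma coreS N x : core N x -> core N.+1 x.
Proof.
elim: N x => [|N IH] x; elim/lin_span_ind => {x} [|x y|k x|x]; try
  by [exact: lin_span0|exact: lin_spanD|exact: lin_spanZ].
- by move=> [v _ <-]; exact: core_vertex.
- move=> [[v _ <-]|[e [f [m [/IH cm ->]]]]]; first exact: core_vertex.
  by apply: lin_span_gen; right; exists e, f, m.
Qed.

Lemma core_le N M x : (N <= M)%N -> core N x -> core M x.
Proof. by move=> /subnK <- cx; elim: (M - N)%N => //= n; exact: coreS. Qed.

Lemma core_sandwich N v w x : core N x -> core N (lvert K v ** x ** lvert K w).
Proof.
elim: N x => [|N IH] x; elim/lin_span_ind => {x} [|x y|k x|x]; try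
  by [rewrite numul0r numul0l; exact: lin_span0|
      rewrite numulDr numulDl; exact: lin_spanD|
      rewrite numulZr numulZl; exact: lin_spanZ].
- move=> [u _ <-]; rewrite lvert_mul; case: eqP => [->|_].
    by rewrite lvert_mul; case: eqP => _; [exact: (core_vertex 0)|exact: (core0 0)].
  by rewrite numul0l; exact: (core0 0).
- move=> [[u _ <-]|[e [f [m [cm ->]]]]].
    rewrite lvert_mul; case: eqP => [->|_].
      by rewrite lvert_mul; case: eqP => _; [exact: core_vertex|exact: core0].
    by rewrite numul0l; exact: core0.
  rewrite !numulA lvert_edge; case: eqP => _; last by rewrite !numul0l; exact: core0.
  rewrite -numulA lghost_vert; case: eqP => _; last by rewrite numul0r; exact: core0.
  by apply: lin_span_gen; right; exists e, f, m.
Qed.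

Lemma core_path p q : plen p = plen q -> exists N, core N (lpath K p ** lpath_star K q).
Proof.
elim/(@gpath_ind_cons K): p q => [v|e p p' [_ _ _ lp [-> _]] IH] q.
  case: q => [w|] //= _; exists 0%N; rewrite lvert_mul; case: eqP => _.
    exact: core_vertex.
  exact: core0.
have [[v ->]|[f [q' [_ _ _ lq [_ ->]]]]] := gpath_caseP K q; first by rewrite lp.
rewrite lp lq => -[/IH[N pq]]; exists N.+1; apply: lin_span_gen; right.
by exists e, f, (lpath K p ** lpath_star K q'); rewrite !numulA.
Qed.

Lemma lpa_comp0_core x : lpa_comp 0 x -> exists N, core N x.
Proof.
elim/lin_span_ind => {x} [|x y [N Nx] [M My]|k x [N Nx]|_ [p [q [pq ->]]]].
- by exists 0%N; exact: core0.
- exists (maxn N M); apply: coreD; first by apply: core_le Nx; exact: leq_maxl.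
  by apply: core_le My; exact: leq_maxr.
- by exists N; case: N Nx => [|N]; exact: lin_spanZ.
- by apply: core_path; move/eqP: pq; rewrite subr_eq0 => /eqP[].
Qed.

Lemma core_split N x : core N.+1 x ->
  exists a y, [/\ core 0 a, edge_core N y & x = a + y].
Proof.
elim/lin_span_ind => {x} [|x y [a [b [ca cb ->]]] [c [d [cc cd ->]]]|k x|x].
- by exists 0, 0; split; rewrite ?addr0 //; exact: lin_span0.
- exists (a + c), (b + d); split; [exact: lin_spanD|exact: lin_spanD|].
  by rewrite addrACA.
- move=> [a [b [ca cb ->]]]; exists (k *: a), (k *: b).
  by split; [exact: lin_spanZ|exact: lin_spanZ|rewrite scalerDr].
- move=> [xv|xe]; [exists x, 0|exists 0, x]; split; rewrite ?addr0 ?add0r //;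
    by [exact: lin_span_gen|exact: lin_span0].
Qed.

(** The span of the vertices is a sum of copies of [K]. *)
Lemma core0_scalar a : core 0 a -> forall v, exists k,
  a ** lvert K v = k *: lvert K v /\ lvert K v ** a = k *: lvert K v.
Proof.
elim/lin_span_ind => {a} [|a b IHa IHb|k a IHa|_ [w _ <-]] v.
- by exists 0; rewrite numul0l numul0r scale0r.
- have [[k [ka ak]] [l [lb bl]]] := (IHa v, IHb v); exists (k + l).
  by rewrite numulDl numulDr ka ak lb bl scalerDl.
- have [l [la al]] := IHa v; exists (k * l).
  by rewrite numulZl numulZr la al scalerA.
- exists (if v == w then 1 else 0); rewrite !lvert_mul [w == v]eq_sym.
  by case: eqP => [->|_]; rewrite ?scale1r ?scale0r.
Qed.

Lemma edge_core_ghost_edge N e f y :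
  edge_core N y -> core N (lghost K e ** y ** ledge K f).
Proof.
elim/lin_span_ind => {y} [|x y|k x|_ [e' [f' [m [cm ->]]]]].
- by rewrite numul0r numul0l; exact: core0.
- by rewrite numulDr numulDl; exact: coreD.
- by rewrite numulZr numulZl; case: N => [|N]; exact: lin_spanZ.
- rewrite !numulA lghost_edge; case: eqP => _; last by rewrite !numul0l; exact: core0.
  rewrite -numulA lghost_edge; case: eqP => _; last by rewrite numul0r; exact: core0.
  exact: core_sandwich.
Qed.

Definition edge_proj e : {linear L -> L} := numul (ledge K e ** lghost K e).
Definition edge_projr e : {linear L -> L} := numulr (ledge K e ** lghost K e).

Lemma edge_proj_ledge e x : finitely_supported edge_proj (ledge K e ** x).
Proof.
apply: (@finitely_supported1 _ _ _ _ e); rewrite /edge_proj /=.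
  by rewrite !numulA -(numulA _ (lghost K e)) lghost_edge eqxx ledge_rng.
move=> f /negPf fe; rewrite !numulA -(numulA _ (lghost K f)) lghost_edge fe.
by rewrite numul0r !numul0l.
Qed.

Lemma edge_core_left N y : edge_core N y ->
  exists2 r, uniq r & y = \sum_(e <- r) ledge K e ** lghost K e ** y.
Proof.
move=> cy; apply: (@finitely_supportedE _ _ _ edge_proj); move: y cy.
apply: lin_span_ind => [|x y|k x|_ [e [f [m [_ ->]]]]].
- exact: finitely_supported0.
- exact: finitely_supportedD.
- exact: finitely_supportedZ.
- by rewrite -numulA; exact: edge_proj_ledge.
Qed.

Lemma edge_core_right N y : edge_core N y ->
  exists2 r, uniq r & y = \sum_(e <- r) y ** (ledge K e ** lghost K e).
Proof.
move=> cy; apply: (@finitely_supportedE _ _ _ edge_projr); move: y cy.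
apply: lin_span_ind => [|x y|k x|_ [e [f [m [_ ->]]]]].
- exact: finitely_supported0.
- exact: finitely_supportedD.
- exact: finitely_supportedZ.
- apply: (@finitely_supported1 _ _ _ _ f); rewrite /edge_projr /= /numulr.
    by rewrite -!numulA (numulA (lghost K f)) lghost_edge eqxx lvert_rng.
  move=> e' /negPf ee; rewrite -!numulA (numulA (lghost K f)) lghost_edge.
  by rewrite eq_sym ee numul0l !numul0r.
Qed.

(** An ideal [J] that contains the vertices and the [v^H] of an ideal [I]
    contains its homogeneous elements. The comparison is between two ideals,
    and not only with the generated one, so that it can be applied to the images
    of [I] and [J] under the involution. *)

Section Comparison.
Variables I J : set L.
Hypotheses (hI : two_sided_ideal I) (hJ : two_sided_ideal J).
Hypothesis vIJ : forall v, I (lvert K v) -> J (lvert K v).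
Hypothesis bIJ : forall v, ideal_breaking I v -> J (vH K (ideal_vertices I) v).

(** Here [y] is the sum of the [e (e^* y f) f^*], and [e^* y f] lies in [I] and
    one level lower in the filtration. *)
Lemma edge_core_ideal N y : (forall x, core N x -> I x -> J x) ->
  edge_core N y -> I y -> J y.
Proof.
move=> IH cy Iy.
have [r _ yl] := edge_core_left cy; have [s _ yr] := edge_core_right cy.
rewrite yr; apply: ideal_sum => // f; rewrite yl numul_suml.
apply: ideal_sum => // e.
have -> : ledge K e ** lghost K e ** y ** (ledge K f ** lghost K f) =
  ledge K e ** (lghost K e ** y ** ledge K f) ** lghost K f by rewrite !numulA.
apply: (Defs.idealMr hJ); apply: (Defs.idealMl hJ); apply: IH.
  exact: edge_core_ghost_edge cy.
apply: (Defs.idealMr hI); exact: (Defs.idealMl hI).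
Qed.

Lemma ledge_lghost_core N e : edge_core N (ledge K e ** lghost K e).
Proof.
apply: lin_span_gen; exists e, e, (lvert K (rng e)); split.
  exact: core_vertex.
by rewrite ledge_rng.
Qed.

(** A vertex occurring in an element of [I] can be traded for an element of [I]
    and [J] at the cost of terms [e m f^*]: by (CK2) if it is regular. If it is
    not, compressing the element by [g^*] and [g], for an edge [g] out of [v] not
    involved in [y], gives a multiple of [rng g]; so only finitely many edges
    out of [v] have their range outside [I], and [v^H] makes sense. Compressing
    by [v^H] then shows that it belongs to [I], because [v^H] kills the edges
    whose range is outside [I] and the other ones are in [I]. *)
Lemma vertex_part N a y v k : core 0 a -> edge_core N y -> I (a + y) ->
  lvert K v ** a = k *: lvert K v -> k != 0 ->
  exists z, [/\ I z, J z & edge_core N (lvert K v - z)].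
Proof.
move=> ca cy Ix va k0; pose H := ideal_vertices I.
have [rv|nrv] := pselect (regular v).
  exists 0; split; [exact: ideal0|exact: ideal0|].
  rewrite subr0 (lvert_CK2 _ rv).
  by apply: lin_span_sum => e; exact: ledge_lghost_core.
have [Iv|nIv] := pselect (I (lvert K v)).
  by exists (lvert K v); split=> //; [exact: vIJ|rewrite subrr; exact: lin_span0].
have [r _ yr] := edge_core_left cy.
set B := out_edges v `&` in_edges_of (~` H).
have finB : finite_set B.
  apply: (@sub_finite_set _ _ [set` r]) => [g [/= gv gH]|].
    apply: contrapT => /negP gr; apply: gH.
    apply: (ideal_scale hI k0).
    have <- : lghost K g ** (a + y) ** ledge K g = k *: lvert K (rng g).
      rewrite numulDr [X in _ + X](_ : _ = 0) ?addr0; last first.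
        rewrite yr numul_sumr big_seq big1 // => e er.
        rewrite !numulA lghost_edge; case: eqP => [ge|_].
          by rewrite ge er in gr.
        by rewrite !numul0l.
      rewrite -{1}lghost_src gv -(numulA _ (lvert K v)) va numulZr numulZl.
      by rewrite -gv lghost_src lghost_edge eqxx.
    apply: (Defs.idealMr hI); exact: (Defs.idealMl hI).
  exact: finite_seq.
have IvH : I (vH K H v).
  apply: (ideal_scale hI k0).
  have <- : vH K H v ** (a + y) ** vH K H v - vH K H v ** y ** vH K H v =
      k *: vH K H v.
    rewrite (numulDr _ a) (numulDl (_ ** a)) addrK -{1}(vH_vert _ finB).
    by rewrite -(numulA _ _ a) va numulZr numulZl vH_vert // vHK.
  apply: idealB => //; first by apply: (Defs.idealMr hI); exact: (Defs.idealMl hI).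
  apply: (Defs.idealMr hI); rewrite yr numul_sumr; apply: ideal_sum => // e.
  rewrite !numulA vH_edge //; case: andP => [[_ /asboolP He]|_].
    by do 2!apply: (Defs.idealMr hI); exact: ideal_edge.
  by rewrite !numul0l; exact: ideal0.
have brv : breaking H v.
  have [B0|/set0P B0] := eqVneq B set0.
    case: nIv; move: IvH; rewrite vHE // -/B B0 fset_set0 big_nil subr0 //.
  split=> //; apply: contrapT => fin; apply: nrv; split=> // sv.
  by case: B0 => e []; rewrite sv.
exists (vH K H v); split=> //; first exact: bIJ.
rewrite vHE // subKr.
by apply: lin_span_sum => e; exact: ledge_lghost_core.
Qed.

(** Replacing each vertex occurring in [x] as in [vertex_part] leaves an element
    of [I] in [edge_core N], to which the induction hypothesis applies. *)
Lemma core_ideal N x : core N x -> I x -> J x.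
Proof.
elim: N x => [|N IH] x cx Ix.
  have [r _ ->] := lpa_right_unit x; apply: ideal_sum => // v.
  have [k [kv _]] := core0_scalar cx v; rewrite kv.
  have [->|k0] := eqVneq k 0; first by rewrite scale0r; exact: ideal0.
  apply: (Defs.idealZ hJ); apply: vIJ; apply: (ideal_scale hI k0).
  by rewrite -kv; exact: (Defs.idealMr hI).
have [a [y [ca cy xay]]] := core_split cx.
have /choice[z zP] v : exists z,
    [/\ I z, J z & edge_core N (a ** lvert K v - z)].
  have [k [av va]] := core0_scalar ca v; rewrite av.
  have [->|k0] := eqVneq k 0.
    exists 0; split; [exact: ideal0|exact: ideal0|].
    by rewrite scale0r subr0; exact: lin_span0.
  have [|z [Iz Jz cz]] := vertex_part ca cy _ va k0; first by rewrite -xay.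
  exists (k *: z); split; [exact: (Defs.idealZ hI)|exact: (Defs.idealZ hJ)|].
  by rewrite -scalerBr; exact: lin_spanZ.
have [r _ ar] := lpa_right_unit a.
pose Z := \sum_(v <- r) z v.
have IZ : I Z by apply: ideal_sum => // v; case: (zP v).
have JZ : J Z by apply: ideal_sum => // v; case: (zP v).
rewrite -(subrK Z x); apply: (Defs.idealD hJ) => //.
apply: (edge_core_ideal IH); last exact: idealB.
rewrite xay addrAC; apply: lin_spanD => //.
rewrite {1}ar -sumrB; apply: lin_span_sum => v; by case: (zP v).
Qed.

(** In positive degree [x] is a sum of [e (e^* x)], and [e^* x] lies in [I] and
    has smaller degree. *)
Lemma lpa_comp_nat_ideal (n : nat) x : lpa_comp n%:Z x -> I x -> J x.
Proof.
elim: n x => [|n IH] x nx Ix.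
  by have [N cx] := lpa_comp0_core nx; exact: core_ideal cx Ix.
have [r _ ->] : exists2 r, uniq r &
    x = \sum_(e <- r) ledge K e ** lghost K e ** x.
  apply: (@finitely_supportedE _ _ _ edge_proj); move: x nx {Ix}.
  apply: lin_span_ind => [|x y|k x|_ [p [q [pq ->]]]].
  - exact: finitely_supported0.
  - exact: finitely_supportedD.
  - exact: finitely_supportedZ.
  - have [[v pv]|[e [p' [_ _ _ _ [-> _]]]]] := gpath_caseP K p.
      by move: pq; rewrite pv /= sub0r; case: (plen q).
    by rewrite -numulA; exact: edge_proj_ledge.
apply: ideal_sum => // e; rewrite -numulA; apply: (Defs.idealMl hJ).
apply: IH; last exact: (Defs.idealMl hI).
have := lpa_comp_ghost_mul e nx.
by rewrite -addn1 PoszD addrK.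
Qed.

End Comparison.

Lemma star_ideal I : two_sided_ideal I -> two_sided_ideal [set x | I (lpa_star kstar x)].
Proof.
move=> hI; split=> /= [|x y Ix Iy|k x Ix|a x Ix|a x Ix].
- by rewrite lpa_star0; exact: ideal0.
- by rewrite lpa_starD; exact: (Defs.idealD hI).
- by rewrite lpa_starZ; exact: (Defs.idealZ hI).
- by rewrite lpa_starM; exact: (Defs.idealMr hI).
- by rewrite lpa_starM; exact: (Defs.idealMl hI).
Qed.

Lemma lpa_comp_ideal I J n x : involutive kstar ->
  two_sided_ideal I -> two_sided_ideal J ->
  (forall v, I (lvert K v) -> J (lvert K v)) ->
  (forall v, ideal_breaking I v -> J (vH K (ideal_vertices I) v)) ->
  lpa_comp n x -> I x -> J x.
Proof.
move=> kK hI hJ vIJ bIJ nx Ix.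
(* The involution turns a negative degree into a positive one. *)
case: n nx => [n|n] nx; first exact: (lpa_comp_nat_ideal hI hJ vIJ bIJ nx).
rewrite -(lpa_starK kK x).
pose sI := [set z : L | I (lpa_star kstar z)].
pose sJ := [set z : L | J (lpa_star kstar z)].
have sv : ideal_vertices sI = ideal_vertices I.
  by apply/seteqP; split=> v; rewrite /ideal_vertices /sI /= lpa_star_vert.
apply: (@lpa_comp_nat_ideal sI sJ (star_ideal hI) (star_ideal hJ) _ _ n.+1).
- by move=> v; rewrite /sI /sJ /= lpa_star_vert; exact: vIJ.
- move=> v; rewrite /ideal_breaking /= sv => -[brv].
  have [_ _ _ finB] := brv.
  rewrite /sI /sJ /= vH_star // => IvH; apply: bIJ; split=> //.
- by have := lpa_comp_star kstar nx; rewrite NegzE opprK.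
- by rewrite /sI /= lpa_starK.
Qed.

Lemma graded_ideal_HS I : involutive kstar -> graded_ideal I ->
  ideal_HS (ideal_vertices I) (ideal_breaking I) = I.
Proof.
move=> kK [hI grI]; apply/seteqP; split.
  by apply: smallest_sub => // _ [[v vI <-]|[v [_ vI] <-]].
move=> x /grI[s [f [fI ->]]].
have hJ := ideal_gen_ideal (@lvert K E @` ideal_vertices I `|`
  @vH K E (ideal_vertices I) @` ideal_breaking I).
apply: (ideal_sum _ hJ) => n; have [In nf] := fI n.
apply: (lpa_comp_ideal kK hI hJ _ _ nf In) => v vI; apply: sub_gen_smallest.
  by left; exists v.
by right; exists v.
Qed.

End GradedIdeals.

Theorem theorem3p3 (K : fieldType) (kstar : {rmorphism K -> K})
    (kstarK : involutive kstar) (E : digraph) :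
  (forall (H S : set (vertex E)) (adm : admissible_pair H S),
     graded_star_isomorphic kstar (porcupine adm) (ideal_HS H S)) /\
  (forall I : set (lpa K E), graded_ideal I ->
     exists F : digraph, graded_star_isomorphic kstar F I).
Proof.
split=> [H S adm|I grI]; first exact: porcupine_iso.
have adm := ideal_admissible (proj1 grI).
exists (porcupine adm).
rewrite -[X in graded_star_isomorphic _ _ X](graded_ideal_HS kstarK grI).
exact: porcupine_iso.
Qed.
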